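(* Let $n\ge 3$ and let $Q\in\mathbf S(s_1,\dots,s_n)$ be tangential, with inscribed circle $\sigma(Q)$ of signed radius $r$ and center $O$. If $r>0$, then $Q$ is a nondegenerate (Morse) critical point of $\mathcal P|_{\mathbf S}$ and its Morse index is $$\mu_Q(\mathcal P)=RT-1+2\omega_Q-\begin{cases}1,&\mathcal P(Q)>0,\\0,&\text{otherwise}.\end{cases}$$ If $r<0$, then $$\mu_Q(\mathcal P)=n-3-\mu_{-Q}(\mathcal P)=LT-1-2\omega_Q-\begin{cases}1,&\mathcal P(Q)>0,\\0,&\text{otherwise}.\end{cases}$$
   Context: Fix $n\ge 3$ pairwise non-parallel lines $s_1,\dots,s_n\subset\mathbb{R}^2$ through the origin, each with a fixed direction $\vec s_i$. For lines $e_i\parallel s_i$, $Q=Q(e_1,\dots,e_n)$ is the closed polygon with consecutive vertices $v_i=e_i\cap e_{i+1}$ (indices mod $n$), and $\widetilde{\mathbf S}(s_1,\dots,s_n)$ is the space of such polygons modulo translations. Oriented area: $\mathcal A=\frac12\sum_i(x_iy_{i+1}-x_{i+1}y_i)$ for $v_i=(x_i,y_i)$; $\mathbf S=\{Q\in\widetilde{\mathbf S}:|\mathcal A(Q)|=1\}$. Each $e_i$ is oriented along $\vec s_i$, giving $\vec e_i$; the perimeter is $\mathcal P(Q)=\sum_i\operatorname{sign}_Q(i)|v_iv_{i+1}|$ with $\operatorname{sign}_Q(i)=1$ if $\vec e_i$ is codirected with $\overrightarrow{v_iv_{i+1}}$ and $-1$ otherwise. $Q$ is tangential if there is a circle $\sigma$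 tangent to every $e_i$ lying either to the left of all $\vec e_i$ or to the right of all $\vec e_i$; its signed radius is its radius with sign $+$ if it lies to the left and $-$ otherwise. $-Q=Q(-e_1,\dots,-e_n)$ (point reflection). $\omega_Q$ is the winding number of the closed broken line $v_1v_2\dots v_n$ around $O$. For an ordered pair of directed slopes $(\vec s_i,\vec s_j)$ we have a right turn (resp. left turn) if $\vec s_j$ is obtained from $\vec s_i$ by a clockwise (resp. counterclockwise) rotation by an angle smaller than $\pi$. $RT$ (resp. $LT$) is the number of right (resp. left) turns among the pairs $(\vec s_1,\vec s_2),(\vec s_2,\vec s_3),\dots,(\vec s_n,\vec s_1)$. $\mu_Q(\mathcal P)$ is the number of negative eigenvalues of the Hessian of $\mathcal P|_{\mathbf S}$ at $Q$.
   Formalization: In the perimeter, the sign of the side v_i v_{i+1} is taken from the orientation of e_{i+1}, the line containing that side when v_i = e_i ∩ e_{i+1}, rather than from e_i, which is not parallel to it. *)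

(* Defs.v *)
From Stdlib Require Export Reals.
Open Scope R_scope.

Definition vec := (R * R)%type.
Definition cross (a b : vec) : R := fst a * snd b - snd a * fst b.
Definition dot (a b : vec) : R := fst a * fst b + snd a * snd b.
Definition vnorm (a : vec) : R := sqrt (dot a a).
Definition vsub (a b : vec) : vec := (fst a - fst b, snd a - snd b).

Fixpoint rsum (k : nat) (f : nat -> R) : R :=
  match k with O => 0 | S k' => rsum k' f + f k' end.
Fixpoint natsum (k : nat) (f : nat -> nat) : nat :=
  match k with O => O | S k' => (natsum k' f + f k')%nat end.

Definition nxt (n i : nat) : nat := Nat.modulo (S i) n.

(* ---------- polygons Q(e_0,...,e_{n-1}) ----------
   s : nat -> vec gives the directions s_0..s_{n-1} (indices < n used).
   h : nat -> R encodes the oriented lines e_i = { p | cross (s i) p = h i },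
   oriented along s i.  A point p is to the LEFT of e_i iff
   cross (s i) p - h i > 0. *)

(* intersection point of {cross a p = h1} and {cross b p = h2} (Cramer) *)
Definition line_meet (a : vec) (h1 : R) (b : vec) (h2 : R) : vec :=
  let D := cross a b in
  ((h1 * fst b - fst a * h2) / D, (snd b * h1 - snd a * h2) / D).

Definition vertex (s : nat -> vec) (n : nat) (h : nat -> R) (i : nat) : vec :=
  line_meet (s i) (h i) (s (nxt n i)) (h (nxt n i)).

Definition area (s : nat -> vec) (n : nat) (h : nat -> R) : R :=
  / 2 * rsum n (fun i => cross (vertex s n h i) (vertex s n h (nxt n i))).

(* signed length of a segment w lying on a line directed by d:
   +|w| if w is codirected with d, -|w| otherwise *)
Definition signed_len (w d : vec) : R :=
  (if Rlt_dec 0 (dot w d) then 1 else -1) * vnorm w.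

(* signed perimeter: the side v_i v_{i+1} lies on e_{i+1} *)
Definition perimeter (s : nat -> vec) (n : nat) (h : nat -> R) : R :=
  rsum n (fun i => signed_len (vsub (vertex s n h (nxt n i)) (vertex s n h i))
                              (s (nxt n i))).

(* signed distance from the point c to the oriented line {cross d p = hh}:
   positive iff c lies to the left *)
Definition signed_dist (d : vec) (hh : R) (c : vec) : R :=
  (cross d c - hh) / vnorm d.

(* Q is tangential, with inscribed circle of center c and signed radius r:
   the circle of radius |r| centered at c is tangent to every e_i and lies
   to the left of all e_i (r > 0) or to the right of all e_i (r < 0). *)
Definition Tangential (s : nat -> vec) (n : nat) (h : nat -> R) (c : vec) (r : R) : Prop :=
  r <> 0 /\ forall i, (i < n)%nat -> signed_dist (s i) (h i) c = r.

Definition atan2 (y x : R) : R :=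
  if Rlt_dec 0 x then atan (y / x)
  else if Rlt_dec x 0 then
         (if Rle_dec 0 y then atan (y / x) + PI else atan (y / x) - PI)
  else if Rlt_dec 0 y then PI / 2
  else if Rlt_dec y 0 then - (PI / 2) else 0.

Definition angle (a b : vec) : R := atan2 (cross a b) (dot a b).

Definition winding (s : nat -> vec) (n : nat) (h : nat -> R) : R :=
  rsum n (fun i => angle (vertex s n h i) (vertex s n h (nxt n i))) / (2 * PI).

Definition RT (s : nat -> vec) (n : nat) : nat :=
  natsum n (fun i => if Rlt_dec (cross (s i) (s (nxt n i))) 0 then 1%nat else 0%nat).
Definition LT (s : nat -> vec) (n : nat) : nat :=
  natsum n (fun i => if Rlt_dec 0 (cross (s i) (s (nxt n i))) then 1%nat else 0%nat).

(* ---------- the manifold S and the Hessian of P|_S ----------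
   Polygons modulo translations: translating by t maps h to
   h + (cross (s i) t)_i.  Curves in S are handled through lifts to the
   space of lines (A and P are translation invariant). *)

Definition curve := R -> nat -> R.

Definition C2curve (n : nat) (g : curve) : Prop :=
  forall i, (i < n)%nat ->
    exists d : R -> R,
      (forall t, derivable_pt_lim (fun t => g t i) t (d t)) /\
      exists a, derivable_pt_lim d 0 a.

Definition admissible (s : nat -> vec) (n : nat) (h : nat -> R) (g : curve) : Prop :=
  C2curve n g /\ (forall i, (i < n)%nat -> g 0 i = h i) /\
  forall t, Rabs (area s n (g t)) = 1.

Definition velocity (n : nat) (g : curve) (v : nat -> R) : Prop :=
  forall i, (i < n)%nat -> derivable_pt_lim (fun t => g t i) 0 (v i).

Definition SecondDeriv (f : R -> R) (c : R) : Prop :=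
  exists f1 : R -> R, (forall t, derivable_pt_lim f t (f1 t)) /\ derivable_pt_lim f1 0 c.

Definition tangentS (s : nat -> vec) (n : nat) (h : nat -> R) (v : nat -> R) : Prop :=
  exists g, admissible s n h g /\ velocity n g v.

Definition CriticalS (s : nat -> vec) (n : nat) (h : nat -> R) : Prop :=
  forall g c, admissible s n h g ->
    derivable_pt_lim (fun t => perimeter s n (g t)) 0 c -> c = 0.

Definition hess_neg (s : nat -> vec) (n : nat) (h : nat -> R) (v : nat -> R) : Prop :=
  tangentS s n h v /\
  forall g c, admissible s n h g -> velocity n g v ->
    SecondDeriv (fun t => perimeter s n (g t)) c -> c < 0.

Definition lincomb (k : nat) (w : nat -> nat -> R) (c : nat -> R) : nat -> R :=
  fun i => rsum k (fun j => c j * w j i).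

(* w_0..w_{k-1} span a k-dimensional subspace of T_Q S on which the
   Hessian is negative definite *)
Definition NegFamily (s : nat -> vec) (n : nat) (h : nat -> R) (k : nat)
  (w : nat -> nat -> R) : Prop :=
  forall c, (exists j, (j < k)%nat /\ c j <> 0) -> hess_neg s n h (lincomb k w c).

(* Morse index = number of negative eigenvalues of the Hessian
   = maximal dimension of a negative definite subspace *)
Definition MorseIndex (s : nat -> vec) (n : nat) (h : nat -> R) (m : nat) : Prop :=
  (exists w, NegFamily s n h m w) /\
  forall k w, NegFamily s n h k w -> (k <= m)%nat.

(* tangent vectors that are zero in the quotient by translations *)
Definition translation_vec (s : nat -> vec) (n : nat) (v : nat -> R) : Prop :=
  exists t : vec, forall i, (i < n)%nat -> v i = cross (s i) t.

(* the Hessian bilinear form (by polarization) is nondegenerate on T_Q S *)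
Definition NondegS (s : nat -> vec) (n : nat) (h : nat -> R) : Prop :=
  forall v, tangentS s n h v ->
    (forall v', tangentS s n h v' ->
       forall g1 g2 g3 c1 c2 c3,
         admissible s n h g1 -> velocity n g1 (fun i => v i + v' i) ->
         admissible s n h g2 -> velocity n g2 v ->
         admissible s n h g3 -> velocity n g3 v' ->
         SecondDeriv (fun t => perimeter s n (g1 t)) c1 ->
         SecondDeriv (fun t => perimeter s n (g2 t)) c2 ->
         SecondDeriv (fun t => perimeter s n (g3 t)) c3 ->
         c1 - c2 - c3 = 0) ->
    translation_vec s n v.

Definition indicator_pos (x : R) : R := if Rlt_dec 0 x then 1 else 0.

(* Main.v *)
(** Write [B] for the bilinear form with [area h = - B h h / 2].  Adding and removing
    the corners at [e_0] cuts the polygon into the triangles bounded by the lines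
    [e_0, e_(k+1), e_(k+2)], and the area of the triangle cut out by three lines is the
    square of a linear form divided by a product of three cross products; so [B] is
    diagonalised explicitly, its kernel is the space of translations, and the number of
    its negative squares is read off from the orientations of the triples
    [(s_0, s_(k+1), s_(k+2))].  Summing over the same fan the antisymmetric quantity
    [1 - 1/2 + angle / PI] (right turn) or [- 1/2 + angle / PI] (left turn) identifies
    this number with [RT - 1 + 2 * winding].

    The perimeter is linear, namely [B] applied to the lengths of the [s_i], hence
    [B h = - r * perimeter] at a tangential polygon [h].  Therefore [h] is critical, and
    differentiating [B g g = const] twice along a curve shows that the Hessian is
    [B v v / r] on the [B]-orthogonal of [h]; passing to this orthogonal removes one
    square, whose sign is that of [- perimeter h]. *)

Require Import Defs.
From Stdlib Require Import Reals Lra Lia Arith FunctionalExtensionality.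
From Coquelicot Require Import Coquelicot.
Open Scope R_scope.

(** * Finite sums and finite choice *)

Lemma rsum_ext (k : nat) (f g : nat -> R) :
  (forall i, (i < k)%nat -> f i = g i) -> rsum k f = rsum k g.
Proof.
  induction k as [|k IH]; intros H; simpl; [reflexivity|].
  rewrite IH by (intros; apply H; lia). rewrite H by lia. reflexivity.
Qed.

Lemma rsum_plus (k : nat) (f g : nat -> R) :
  rsum k (fun i => f i + g i) = rsum k f + rsum k g.
Proof. induction k as [|k IH]; simpl; [lra|]. rewrite IH. ring. Qed.

Lemma rsum_scal (k : nat) (a : R) (f : nat -> R) :
  rsum k (fun i => a * f i) = a * rsum k f.
Proof. induction k as [|k IH]; simpl; [ring|]. rewrite IH. ring. Qed.

Lemma rsum_const (k : nat) (a : R) : rsum k (fun _ => a) = INR k * a.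
Proof. induction k as [|k IH]; [simpl; ring|]. rewrite S_INR. simpl. rewrite IH. ring. Qed.

Lemma rsum_0 (k : nat) (f : nat -> R) :
  (forall i, (i < k)%nat -> f i = 0) -> rsum k f = 0.
Proof.
  intros H. rewrite (rsum_ext k f (fun _ => 0)) by exact H. rewrite rsum_const. ring.
Qed.

Lemma rsum_le (k : nat) (f g : nat -> R) :
  (forall i, (i < k)%nat -> f i <= g i) -> rsum k f <= rsum k g.
Proof.
  induction k as [|k IH]; intros H; simpl; [lra|].
  assert (rsum k f <= rsum k g) by (apply IH; intros; apply H; lia).
  assert (f k <= g k) by (apply H; lia). lra.
Qed.

Lemma rsum_nonneg (k : nat) (f : nat -> R) :
  (forall i, (i < k)%nat -> 0 <= f i) -> 0 <= rsum k f.
Proof.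
  intros H. assert (H0 := rsum_le k (fun _ => 0) f H).
  rewrite rsum_const in H0. lra.
Qed.

Lemma rsum_neg (k j : nat) (f : nat -> R) :
  (forall i, (i < k)%nat -> f i <= 0) -> (j < k)%nat -> f j < 0 -> rsum k f < 0.
Proof.
  induction k as [|k IH]; intros H Hj Hf; [lia|]. simpl.
  assert (Hk : f k <= 0) by (apply H; lia).
  destruct (Nat.eq_dec j k) as [->|Hjk].
  - assert (rsum k f <= rsum k (fun _ => 0)) by (apply rsum_le; intros; apply H; lia).
    rewrite rsum_const in H0. lra.
  - assert (rsum k f < 0) by (apply IH; [intros; apply H; lia|lia|exact Hf]). lra.
Qed.

Lemma rsum_single (k j : nat) (f : nat -> R) :
  (j < k)%nat -> (forall i, (i < k)%nat -> i <> j -> f i = 0) -> rsum k f = f j.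
Proof.
  induction k as [|k IH]; intros Hj H; [lia|]. simpl.
  destruct (Nat.eq_dec j k) as [->|Hjk].
  - rewrite rsum_0; [ring|]. intros; apply H; lia.
  - rewrite IH by (try lia; intros; apply H; lia). rewrite (H k) by lia. ring.
Qed.

Lemma INR_natsum (k : nat) (f : nat -> nat) :
  INR (natsum k f) = rsum k (fun i => INR (f i)).
Proof. induction k as [|k IH]; simpl; [reflexivity|]. rewrite plus_INR, IH. reflexivity. Qed.

(** Induction on [k] stands in for the axiom of choice. It gathers the derivatives that [C2curve]
    provides one coordinate at a time into a single family. *)
Lemma finite_choice (A : Type) (a0 : A) (P : nat -> A -> Prop) (k : nat) :
  (forall i, (i < k)%nat -> exists x, P i x) ->
  exists f, forall i, (i < k)%nat -> P i (f i).
Proof.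
  induction k as [|k IH]; intros H.
  - exists (fun _ => a0). intros; lia.
  - destruct IH as [f Hf]; [intros; apply H; lia|].
    destruct (H k) as [x Hx]; [lia|].
    exists (fun i => if Nat.eq_dec i k then x else f i). intros i Hi.
    destruct (Nat.eq_dec i k) as [->|Hik]; [exact Hx|apply Hf; lia].
Qed.

(** * Indices of diagonal quadratic forms *)

Definition count (P : nat -> bool) (m : nat) : nat :=
  natsum m (fun k => if P k then 1%nat else 0%nat).

(** Turns a subset of the coordinates into a family indexed by an initial segment of [nat], the
    shape that [lincomb] expects. *)
Lemma count_enum (P : nat -> bool) (m : nat) :
  exists iota : nat -> nat,
    (forall j, (j < count P m)%nat -> (iota j < m)%nat /\ P (iota j) = true) /\
    (forall i j, (i < count P m)%nat -> (j < count P m)%nat -> iota i = iota j -> i = j) /\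
    (forall k, (k < m)%nat -> P k = true -> exists j, (j < count P m)%nat /\ iota j = k).
Proof.
  induction m as [|m [iota [H1 [H2 H3]]]].
  - exists (fun _ => 0%nat). unfold count; simpl. repeat split; intros; lia.
  - unfold count in *; simpl. destruct (P m) eqn:Pm.
    + set (N := natsum m (fun k => if P k then 1%nat else 0%nat)) in *.
      exists (fun j => if Nat.eq_dec j N then m else iota j). repeat split.
      * destruct (Nat.eq_dec j N); [lia|]. destruct (H1 j); lia.
      * destruct (Nat.eq_dec j N); [exact Pm|]. apply H1; lia.
      * intros i j Hi Hj.
        destruct (Nat.eq_dec i N), (Nat.eq_dec j N); intros E.
        -- lia.
        -- destruct (H1 j); lia.
        -- destruct (H1 i); lia.
        -- apply H2; lia.
      * intros k Hk Pk. destruct (Nat.eq_dec k m) as [->|Hkm].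
        -- exists N. destruct (Nat.eq_dec N N); [split; lia|lia].
        -- destruct (H3 k) as [j [Hj E]]; [lia|exact Pk|].
           exists j. destruct (Nat.eq_dec j N); [lia|split; lia].
    + exists iota. rewrite Nat.add_0_r. repeat split.
      * destruct (H1 j); lia.
      * apply H1; lia.
      * exact H2.
      * intros k Hk Pk. apply H3; [|exact Pk].
        destruct (Nat.eq_dec k m) as [->|]; [congruence|lia].
Qed.

Lemma count_remove (P : nat -> bool) (m p : nat) :
  (p < m)%nat -> P p = true ->
  (count (fun k => (P k && negb (k =? p))%bool) m + 1 = count P m)%nat.
Proof.
  assert (E : forall q, (q <= p)%nat ->
    count (fun k => (P k && negb (k =? p))%bool) q = count P q).
  { unfold count. induction q as [|q IH]; intros Hq; simpl; [reflexivity|].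
    rewrite IH by lia. destruct (Nat.eqb_spec q p); [lia|].
    destruct (P q); reflexivity. }
  unfold count in *. induction m as [|m IH]; intros Hp Pp; [lia|]. simpl.
  destruct (Nat.eqb_spec m p) as [->|Hmp].
  - rewrite E by lia. rewrite Pp. simpl. lia.
  - rewrite <- IH by (lia || assumption). destruct (P m); simpl; lia.
Qed.

Lemma count_ext (P P' : nat -> bool) (m : nat) :
  (forall k, (k < m)%nat -> P k = P' k) -> count P m = count P' m.
Proof.
  unfold count. induction m as [|m IH]; intros H; simpl; [reflexivity|].
  rewrite IH by (intros; apply H; lia). rewrite H by lia. reflexivity.
Qed.

Lemma count_compl (P P' : nat -> bool) (m : nat) :
  (forall k, (k < m)%nat -> P k = negb (P' k)) -> (count P m + count P' m = m)%nat.
Proof.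
  unfold count. induction m as [|m IH]; intros H; simpl; [reflexivity|].
  assert (IH' := IH (fun k Hk => H k (Nat.lt_lt_succ_r _ _ Hk))).
  rewrite H by lia. destruct (P' m); simpl; lia.
Qed.

Definition nonzero_below (k : nat) (c : nat -> R) : Prop :=
  exists j, (j < k)%nat /\ c j <> 0.

Lemma nonzero_below_dec (k : nat) (c : nat -> R) :
  nonzero_below k c \/ forall j, (j < k)%nat -> c j = 0.
Proof.
  induction k as [|k [[j [Hj Hc]]|H]].
  - right; intros; lia.
  - left; exists j; split; [lia|exact Hc].
  - destruct (Req_dec (c k) 0) as [E|E].
    + right. intros j Hj. destruct (Nat.eq_dec j k) as [->|]; [exact E|apply H; lia].
    + left. exists k. split; [lia|exact E].
Qed.

(** Gaussian elimination, by induction on the number of equations. If some unknown [p] has a nonzero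
    coefficient in the last equation, that equation eliminates it; otherwise the last equation is
    vacuous. *)
Lemma homogeneous_system (N : nat) : forall (K : nat) (w : nat -> nat -> R),
  (N < K)%nat ->
  exists c, nonzero_below K c /\
    forall i, (i < N)%nat -> rsum K (fun j => c j * w j i) = 0.
Proof.
  induction N as [|N IH]; intros K w HK.
  - exists (fun _ => 1). split; [exists 0%nat; split; [lia|lra]|intros; lia].
  - destruct (nonzero_below_dec K (fun j => w j N)) as [[p [Hp Wp]]|H0].
    + destruct K as [|K]; [lia|].
      (* [sk] enumerates the indices other than the pivot [p]; its left inverse is [un] below. *)
      set (sk := fun j => if (j <? p)%nat then j else S j).
      assert (Hsk : forall f : nat -> R,
        rsum (S K) f = f p + rsum K (fun j => f (sk j))).
      { intros f. clear - Hp. unfold sk. clear sk. revert Hp.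
        induction K as [|K IHK]; intros Hp.
        - assert (p = 0)%nat as -> by lia. simpl. ring.
        - change (rsum (S K) f + f (S K) =
                  f p + (rsum K (fun j => f (if (j <? p)%nat then j else S j))
                         + f (if (K <? p)%nat then K else S K))).
          destruct (Nat.ltb_spec K p).
          + assert (p = S K) as -> by lia. simpl.
            rewrite (rsum_ext K (fun j => f (if (j <? S K)%nat then j else S j)) f).
            * ring.
            * intros i Hi. destruct (Nat.ltb_spec i (S K)); [reflexivity|lia].
          + rewrite IHK by lia. ring. }
      destruct (IH K (fun j i => w (sk j) i - w (sk j) N / w p N * w p i))
        as [c [[q [Hq Cq]] Hc]]; [lia|].
      set (un := fun j => if (j <? p)%nat then j else (j - 1)%nat).
      assert (Hun : forall j, un (sk j) = j).
      { intros j. unfold un, sk. destruct (Nat.ltb_spec j p).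
        - destruct (Nat.ltb_spec j p); lia.
        - destruct (Nat.ltb_spec (S j) p); lia. }
      assert (Hskp : forall j, sk j <> p).
      { intros j. unfold sk. destruct (Nat.ltb_spec j p); lia. }
      (* The value that equation [N] forces on the eliminated unknown. *)
      set (cp := - rsum K (fun j => c j * (w (sk j) N / w p N))).
      exists (fun j => if Nat.eq_dec j p then cp else c (un j)). split.
      * exists (sk q). split.
        -- unfold sk. destruct (Nat.ltb_spec q p); lia.
        -- destruct (Nat.eq_dec (sk q) p) as [E|E]; [destruct (Hskp q E)|].
           rewrite Hun. exact Cq.
      * intros i Hi. rewrite Hsk. destruct (Nat.eq_dec p p) as [_|]; [|lia].
        rewrite (rsum_ext K _ (fun j => c j * w (sk j) i)).
        2:{ intros j Hj. destruct (Nat.eq_dec (sk j) p) as [E|E]; [destruct (Hskp j E)|].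
            rewrite Hun. reflexivity. }
        replace (cp * w p i) with (rsum K (fun j => - w p i * (c j * (w (sk j) N / w p N)))).
        2:{ rewrite rsum_scal. unfold cp. ring. }
        rewrite <- rsum_plus. destruct (Nat.eq_dec i N) as [->|HiN].
        -- apply rsum_0. intros j Hj. field. exact Wp.
        -- rewrite <- (Hc i) by lia. apply rsum_ext. intros j Hj. ring.
    + destruct (IH K w) as [c [Hc1 Hc2]]; [lia|].
      exists c. split; [exact Hc1|]. intros i Hi.
      destruct (Nat.eq_dec i N) as [->|]; [|apply Hc2; lia].
      apply rsum_0. intros j Hj. rewrite H0 by exact Hj. ring.
Qed.

Definition linear_form (f : (nat -> R) -> R) : Prop :=
  f (fun _ => 0) = 0 /\
  forall v w a, f (fun i => v i + a * w i) = f v + a * f w.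

Lemma linear_form_lincomb (f : (nat -> R) -> R) (K : nat) w c :
  linear_form f -> f (lincomb K w c) = rsum K (fun j => c j * f (w j)).
Proof.
  intros [H0 H]. induction K as [|K IH]; [exact H0|].
  transitivity (f (fun i => lincomb K w c i + c K * w K i)); [reflexivity|].
  rewrite H, IH. reflexivity.
Qed.

Definition diag_form (m : nat) (tau : nat -> R) (L : nat -> (nat -> R) -> R)
  (v w : nat -> R) : R :=
  rsum m (fun k => tau k * (L k v * L k w)).

Lemma diag_form_sym m tau L v w : diag_form m tau L v w = diag_form m tau L w v.
Proof. apply rsum_ext. intros. ring. Qed.

Lemma diag_form_linear m tau L x :
  (forall k, (k < m)%nat -> linear_form (L k)) -> linear_form (diag_form m tau L x).
Proof.
  intros HL. unfold diag_form. split.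
  - apply rsum_0. intros k Hk. rewrite (proj1 (HL k Hk)). ring.
  - intros v w a. rewrite <- rsum_scal, <- rsum_plus. apply rsum_ext.
    intros k Hk. rewrite (proj2 (HL k Hk)). ring.
Qed.

Lemma diag_form_square_plus m tau L v w a :
  (forall k, (k < m)%nat -> linear_form (L k)) ->
  diag_form m tau L (fun i => v i + a * w i) (fun i => v i + a * w i) =
  diag_form m tau L v v + 2 * a * diag_form m tau L w v + a * a * diag_form m tau L w w.
Proof.
  intros HL.
  rewrite (proj2 (diag_form_linear m tau L _ HL)).
  rewrite (diag_form_sym _ _ _ _ v), (diag_form_sym _ _ _ _ w).
  rewrite !(proj2 (diag_form_linear m tau L _ HL)).
  rewrite (diag_form_sym _ _ _ v w). ring.
Qed.

Definition is_neg (x : R) : bool := if Rlt_dec x 0 then true else false.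

Lemma is_neg_true x : is_neg x = true <-> x < 0.
Proof. unfold is_neg. destruct (Rlt_dec x 0); split; intros; congruence || lra. Qed.

Definition negative_definite_family (q : (nat -> R) -> R) (K : nat) (w : nat -> nat -> R) :=
  forall c, nonzero_below K c -> q (lincomb K w c) < 0.

(** The dimension count behind Sylvester's law of inertia: with more vectors than negative
    coefficients, some nontrivial combination is killed by every [L k] with [tau k < 0], and the
    form is nonnegative on it. *)
Lemma negative_definite_dim m tau L K w :
  (forall k, (k < m)%nat -> linear_form (L k)) ->
  negative_definite_family (fun v => diag_form m tau L v v) K w ->
  (K <= count (fun k => is_neg (tau k)) m)%nat.
Proof.
  intros HL Hneg. destruct (le_lt_dec K (count (fun k => is_neg (tau k)) m)) as [|Hlt];
    [assumption|exfalso].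
  destruct (count_enum (fun k => is_neg (tau k)) m) as [iota [H1 [_ H3]]].
  destruct (homogeneous_system _ K (fun j i => L (iota i) (w j)) Hlt) as [c [Hc Hz]].
  specialize (Hneg c Hc). simpl in Hneg.
  apply Rlt_not_le in Hneg. apply Hneg. apply rsum_nonneg. intros k Hk.
  destruct (is_neg (tau k)) eqn:E.
  - destruct (H3 k Hk E) as [j [Hj <-]].
    rewrite (linear_form_lincomb _ _ _ _ (HL _ Hk)), Hz by exact Hj. lra.
  - assert (0 <= tau k).
    { unfold is_neg in E. destruct (Rlt_dec (tau k) 0); [discriminate|lra]. }
    apply Rmult_le_pos; [assumption|]. apply Rle_0_sqr.
Qed.

(** Projection along [z] onto the kernel of [q] is linear, so it commutes with taking
    combinations. *)
Lemma lincomb_project (q : (nat -> R) -> R) K (e : nat -> nat -> R) (z : nat -> R) c :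
  linear_form q ->
  lincomb K (fun j i => e j i + - (q (e j) / q z) * z i) c =
  (fun i => lincomb K e c i + - (q (lincomb K e c) / q z) * z i).
Proof.
  intros Hq. extensionality i. rewrite (linear_form_lincomb q K e c Hq).
  unfold lincomb. induction K as [|K IH]; simpl; [|rewrite IH]; unfold Rdiv; ring.
Qed.

(* In both cases of the sign of [q h0 h0] the negative coordinate directions are
   projected onto the orthogonal of [h0]: along [h0] itself if [q h0 h0 > 0], which
   only decreases [q], and along one negative coordinate direction otherwise. *)
Lemma diag_form_orthogonal_index m tau L e h0 :
  (forall k, (k < m)%nat -> linear_form (L k)) ->
  (forall j k, (j < m)%nat -> (k < m)%nat -> L j (e k) = if Nat.eq_dec j k then 1 else 0) ->
  diag_form m tau L h0 h0 <> 0 ->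
  exists M,
    (M + (if Rlt_dec (diag_form m tau L h0 h0) 0 then 1 else 0)
       = count (fun k => is_neg (tau k)) m)%nat /\
    (exists w, forall c, nonzero_below M c ->
       diag_form m tau L h0 (lincomb M w c) = 0 /\
       diag_form m tau L (lincomb M w c) (lincomb M w c) < 0) /\
    (forall K w,
       (forall c, nonzero_below K c ->
          diag_form m tau L h0 (lincomb K w c) = 0 /\
          diag_form m tau L (lincomb K w c) (lincomb K w c) < 0) -> (K <= M)%nat).
Proof.
  intros HL He Hh0.
  set (q := diag_form m tau L) in *.
  assert (Hq : forall x, linear_form (q x)) by (intros; apply diag_form_linear, HL).
  assert (Hcoord : forall (P : nat -> bool) iota c k,
    (forall j, (j < count P m)%nat -> (iota j < m)%nat) ->
    (k < m)%nat ->
    L k (lincomb (count P m) (fun j => e (iota j)) c) =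
    rsum (count P m) (fun j => c j * (if Nat.eq_dec k (iota j) then 1 else 0))).
  { intros P iota c k Hi Hk. rewrite linear_form_lincomb by (apply HL, Hk).
    apply rsum_ext. intros j Hj. rewrite He; auto. }
  assert (Hneg : forall v, (forall k, (k < m)%nat -> 0 <= tau k -> L k v = 0) ->
    (exists k, (k < m)%nat /\ tau k < 0 /\ L k v <> 0) -> q v v < 0).
  { intros v Hp [k [Hk [Ht Hv]]].
    assert (Hs : forall x, x <> 0 -> 0 < x * x) by (intros; apply Rsqr_pos_lt; assumption).
    apply rsum_neg with k; [|exact Hk|].
    - intros i Hi. destruct (Rlt_dec (tau i) 0).
      + assert (0 <= L i v * L i v) by apply Rle_0_sqr. nra.
      + rewrite Hp by (assumption || lra). lra.
    - specialize (Hs _ Hv). nra. }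
  assert (Henum : forall (P : nat -> bool) iota c,
    (forall j, (j < count P m)%nat -> (iota j < m)%nat /\ P (iota j) = true) ->
    (forall i j, (i < count P m)%nat -> (j < count P m)%nat -> iota i = iota j -> i = j) ->
    nonzero_below (count P m) c ->
    let u := lincomb (count P m) (fun j => e (iota j)) c in
    (forall k, (k < m)%nat -> P k = false -> L k u = 0) /\
    exists k, (k < m)%nat /\ P k = true /\ L k u <> 0).
  { intros P iota c H1 H2 [j [Hj Cj]] u. split.
    - intros k Hk Pk. unfold u. rewrite Hcoord by (try apply H1; assumption).
      apply rsum_0. intros i Hi. destruct (Nat.eq_dec k (iota i)) as [->|]; [|ring].
      destruct (H1 i Hi). congruence.
    - exists (iota j). destruct (H1 j Hj) as [Hij Pij].
      split; [assumption|split; [assumption|]].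
      unfold u. rewrite Hcoord by (try apply H1; assumption).
      rewrite (rsum_single _ j).
      + destruct (Nat.eq_dec (iota j) (iota j)); [lra|lia].
      + exact Hj.
      + intros i Hi Hne. destruct (Nat.eq_dec (iota j) (iota i)) as [E|]; [|ring].
        apply H2 in E; [|assumption|assumption]. lia. }
  assert (Hproj : forall x z, q h0 z <> 0 ->
     q h0 (fun i => x i + - (q h0 x / q h0 z) * z i) = 0).
  { intros x z Hz. rewrite (proj2 (Hq h0)). field. exact Hz. }
  destruct (Rlt_dec (q h0 h0) 0) as [Hlt|Hge].
  (* Otherwise [q h0 h0] would be a sum of nonnegative terms. For this [p],
     [q h0 (e p) = tau p * L p h0] is nonzero, so projecting along [e p] makes sense. *)
  - assert (Hp : exists p, (p < m)%nat /\ tau p < 0 /\ L p h0 <> 0).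
    { destruct (nonzero_below_dec m (fun k => if Rlt_dec (tau k) 0 then L k h0 else 0))
        as [[p [Hp E]]|H].
      - exists p. destruct (Rlt_dec (tau p) 0); [auto|lra].
      - exfalso. apply Rlt_not_le in Hlt. apply Hlt. apply rsum_nonneg. intros k Hk.
        specialize (H k Hk). simpl in H. destruct (Rlt_dec (tau k) 0).
        + rewrite H. lra.
        + apply Rmult_le_pos; [lra|apply Rle_0_sqr]. }
    destruct Hp as [p [Hp [Htp HLp]]].
    assert (Pp : is_neg (tau p) = true) by (apply is_neg_true, Htp).
    pose (P := fun k => (is_neg (tau k) && negb (k =? p))%bool).
    assert (HC : (count P m + 1 = count (fun k => is_neg (tau k)) m)%nat)
      by exact (count_remove (fun k => is_neg (tau k)) m p Hp Pp).
    destruct (count_enum P m) as [iota [H1 [H2 _]]].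
    assert (Hhp : q h0 (e p) <> 0).
    { unfold q, diag_form. rewrite (rsum_single _ p).
      - rewrite He by assumption. destruct (Nat.eq_dec p p); [|lia].
        intros E. rewrite Rmult_1_r in E. apply Rmult_integral in E. lra.
      - exact Hp.
      - intros i Hi Hne. rewrite He by assumption.
        destruct (Nat.eq_dec i p); [lia|ring]. }
    exists (count P m). split; [exact HC|split].
    + exists (fun j i => e (iota j) i + - (q h0 (e (iota j)) / q h0 (e p)) * e p i).
      intros c Hc.
      rewrite (lincomb_project (q h0) _ (fun j => e (iota j)) (e p) c (Hq h0)).
      split; [apply Hproj, Hhp|].
      destruct (Henum P iota c H1 H2 Hc) as [Hu1 [k [Hk [Pk Hu2]]]].
      unfold P in Pk. apply andb_prop in Pk as [Pk1 Pk2].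
      apply is_neg_true in Pk1. apply Bool.negb_true_iff, Nat.eqb_neq in Pk2.
      (* The projection along [e p] alters only the coordinate [p], whose coefficient is negative;
         the nonnegative coordinates stay zero and the nonzero coordinate [k <> p] survives. *)
      apply Hneg.
      * intros i Hi Ht. rewrite (proj2 (HL i Hi)), He by assumption.
        rewrite Hu1; [|exact Hi|].
        -- destruct (Nat.eq_dec i p) as [->|]; [lra|ring].
        -- unfold P, is_neg. destruct (Rlt_dec (tau i) 0); [lra|reflexivity].
      * exists k. split; [exact Hk|split; [exact Pk1|]].
        rewrite (proj2 (HL k Hk)), He by assumption.
        destruct (Nat.eq_dec k p); [lia|]. rewrite Rmult_0_r, Rplus_0_r. exact Hu2.
    + intros K w Hw.
      (* Since [q h0 h0 < 0], adjoining [h0] to a negative definite family orthogonal to it gives a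
         negative definite family with one more vector. *)
      cut (S K <= count (fun k => is_neg (tau k)) m)%nat; [lia|].
      apply (negative_definite_dim m tau L (S K) (fun j => if Nat.eq_dec j K then h0 else w j) HL).
      intros c [j [Hj Cj]]. fold q.
      assert (E : lincomb (S K) (fun j => if Nat.eq_dec j K then h0 else w j) c =
                  (fun i => lincomb K w c i + c K * h0 i)).
      { extensionality i. unfold lincomb; simpl.
        destruct (Nat.eq_dec K K) as [_|]; [|lia]. f_equal.
        apply rsum_ext. intros l Hl. destruct (Nat.eq_dec l K); [lia|reflexivity]. }
      rewrite E. unfold q. rewrite diag_form_square_plus by exact HL. fold q.
      destruct (nonzero_below_dec K c) as [Hc|Hc].
      * destruct (Hw c Hc) as [E1 E2]. rewrite E1.
        assert (0 <= c K * c K) by apply Rle_0_sqr. nra.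
      * assert (HE : lincomb K w c = fun _ => 0).
        { extensionality i. apply rsum_0. intros l Hl. rewrite Hc by exact Hl. ring. }
        rewrite HE, !(proj1 (Hq _)).
        assert (j = K) as -> by (destruct (Nat.eq_dec j K); [assumption|];
                                 destruct Cj; apply Hc; lia).
        assert (0 < c K * c K) by (apply Rsqr_pos_lt; assumption). nra.
  - pose (P := fun k => is_neg (tau k)).
    destruct (count_enum P m) as [iota [H1 [H2 _]]].
    exists (count P m). split; [apply Nat.add_0_r|split].
    + exists (fun j i => e (iota j) i + - (q h0 (e (iota j)) / q h0 h0) * h0 i).
      intros c Hc.
      rewrite (lincomb_project (q h0) _ (fun j => e (iota j)) h0 c (Hq h0)).
      split; [apply Hproj, Hh0|].
      destruct (Henum P iota c H1 H2 Hc) as [Hu1 [k [Hk [Pk Hu2]]]].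
      assert (Hu : q (lincomb (count P m) (fun j => e (iota j)) c)
                     (lincomb (count P m) (fun j => e (iota j)) c) < 0).
      { apply Hneg.
        - intros i Hi Ht. apply Hu1; [exact Hi|].
          unfold P, is_neg. destruct (Rlt_dec (tau i) 0); [lra|reflexivity].
        - exists k. split; [exact Hk|split; [apply is_neg_true, Pk|exact Hu2]]. }
      set (u := lincomb (count P m) (fun j => e (iota j)) c) in *.
      unfold q. rewrite diag_form_square_plus by exact HL. fold q.
      (* Completing the square: the projection lowers [q u u] by a nonnegative amount because
         [q h0 h0 > 0]. *)
      replace (q u u + 2 * - (q h0 u / q h0 h0) * q h0 u +
               - (q h0 u / q h0 h0) * - (q h0 u / q h0 h0) * q h0 h0)
        with (q u u - (q h0 u * q h0 u) / q h0 h0) by (field; exact Hh0).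
      assert (0 <= (q h0 u * q h0 u) / q h0 h0).
      { apply Rdiv_le_0_compat; [apply Rle_0_sqr|lra]. }
      lra.
    + intros K w Hw. apply (negative_definite_dim m tau L K w HL).
      intros c Hc. apply Hw, Hc.
Qed.

(** * Area and perimeter as fan sums *)

Lemma nxt_lt (n i : nat) : (0 < n)%nat -> (nxt n i < n)%nat.
Proof. intros. apply Nat.mod_upper_bound. lia. Qed.

Lemma nxt_succ (p i : nat) : (i < p)%nat -> nxt (S p) i = S i.
Proof. intros. apply Nat.mod_small. lia. Qed.

Lemma nxt_last (p : nat) : nxt (S p) p = 0%nat.
Proof. apply Nat.Div0.mod_same. Qed.

Lemma nxt_neq (n i : nat) : (2 <= n)%nat -> (i < n)%nat -> nxt n i <> i.
Proof.
  intros Hn Hi. destruct n as [|p]; [lia|].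
  destruct (Nat.eq_dec i p) as [->|]; [rewrite nxt_last; lia|rewrite nxt_succ; lia].
Qed.

Lemma rsum_cycle (p : nat) (F : nat -> nat -> R) :
  rsum (S p) (fun i => F i (nxt (S p) i)) = rsum p (fun i => F i (S i)) + F p 0%nat.
Proof.
  change (rsum p (fun i => F i (nxt (S p) i)) + F p (nxt (S p) p) =
          rsum p (fun i => F i (S i)) + F p 0%nat).
  rewrite nxt_last. f_equal.
  apply rsum_ext. intros i Hi. rewrite nxt_succ by exact Hi. reflexivity.
Qed.

Lemma rsum_succ_l (p : nat) (f : nat -> R) :
  rsum (S p) f = f 0%nat + rsum p (fun i => f (S i)).
Proof.
  induction p as [|p IH]; [simpl; ring|].
  change (rsum (S p) f + f (S p) = f 0%nat + (rsum p (fun i => f (S i)) + f (S p))).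
  rewrite IH. ring.
Qed.

(** This cyclic shift regroups contributions of sides into contributions of corners. *)
Lemma rsum_nxt (n : nat) (f : nat -> R) : rsum n (fun i => f (nxt n i)) = rsum n f.
Proof.
  destruct n as [|p]; [reflexivity|].
  rewrite (rsum_cycle p (fun _ j => f j)), rsum_succ_l. ring.
Qed.

(** Each inner diagonal from [0] is traversed by two neighbouring triangles in opposite directions
    and cancels by antisymmetry. The lemma serves both the corner terms and the turns. *)
Lemma rsum_cycle_fan (n : nat) (F : nat -> nat -> R) :
  (2 <= n)%nat ->
  (forall k, (0 < k < n)%nat -> F k 0%nat = - F 0%nat k) ->
  rsum n (fun i => F i (nxt n i)) =
  rsum (n - 2) (fun k => F 0%nat (S k) + F (S k) (S (S k)) + F (S (S k)) 0%nat).
Proof.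
  intros Hn HF. destruct n as [|[|p]]; [lia|lia|].
  rewrite rsum_cycle. replace (S (S p) - 2)%nat with p by lia. clear Hn.
  induction p as [|p IH].
  - simpl. rewrite HF by lia. ring.
  - change (rsum (S p) (fun i => F i (S i)) + F (S p) (S (S p)) + F (S (S p)) 0%nat =
      rsum p (fun k => F 0%nat (S k) + F (S k) (S (S k)) + F (S (S k)) 0%nat) +
      (F 0%nat (S p) + F (S p) (S (S p)) + F (S (S p)) 0%nat)).
    rewrite <- IH by (intros; apply HF; lia). rewrite (HF (S p)) by lia. ring.
Qed.

(** * Corner terms of the area and the perimeter *)

Definition pairwise_nonparallel (s : nat -> vec) (n : nat) : Prop :=
  forall i j, (i < n)%nat -> (j < n)%nat -> i <> j -> cross (s i) (s j) <> 0.

Lemma cross_anti (a b : vec) : cross a b = - cross b a.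
Proof. unfold cross. ring. Qed.

Lemma dot_comm (a b : vec) : dot a b = dot b a.
Proof. unfold dot. ring. Qed.

Lemma dot_self_pos (a b : vec) : cross a b <> 0 -> 0 < dot a a.
Proof.
  destruct a as [a1 a2], b as [b1 b2]. unfold cross, dot; simpl. intros H.
  assert (0 <= a1 * a1) by apply Rle_0_sqr. assert (0 <= a2 * a2) by apply Rle_0_sqr.
  destruct (Req_dec a1 0) as [->|N1]; [destruct (Req_dec a2 0) as [->|N2]|].
  - destruct H. ring.
  - assert (0 < a2 * a2) by (apply Rsqr_pos_lt; assumption). lra.
  - assert (0 < a1 * a1) by (apply Rsqr_pos_lt; assumption). lra.
Qed.

Lemma vnorm_sqr (a : vec) : vnorm a * vnorm a = dot a a.
Proof.
  apply sqrt_sqrt. unfold dot.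
  assert (0 <= fst a * fst a) by apply Rle_0_sqr.
  assert (0 <= snd a * snd a) by apply Rle_0_sqr. lra.
Qed.

Lemma vnorm_pos (a b : vec) : cross a b <> 0 -> 0 < vnorm a.
Proof. intros H. apply sqrt_lt_R0. apply (dot_self_pos a b H). Qed.

Lemma nonparallel_dot_pos s n i :
  (3 <= n)%nat -> pairwise_nonparallel s n -> (i < n)%nat -> 0 < dot (s i) (s i).
Proof.
  intros Hn HP Hi. apply (dot_self_pos _ (s (nxt n i))). apply HP; [exact Hi| |].
  - apply nxt_lt. lia.
  - apply not_eq_sym, nxt_neq; lia.
Qed.

Lemma nonparallel_vnorm_pos s n i :
  (3 <= n)%nat -> pairwise_nonparallel s n -> (i < n)%nat -> 0 < vnorm (s i).
Proof. intros Hn HP Hi. apply sqrt_lt_R0, (nonparallel_dot_pos s n i Hn HP Hi). Qed.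

(* Each of [area] and [perimeter] is a sum over the corners of the polygon of a
   term depending only on the two lines meeting there. *)
Definition corner (a b : vec) (ha hb ha' hb' : R) : R :=
  ((ha * ha' / dot a a + hb * hb' / dot b b) * dot a b - ha * hb' - hb * ha') / cross a b.

Lemma corner_anti a b ha hb ha' hb' :
  cross a b <> 0 ->
  corner b a hb ha hb' ha' = - corner a b ha hb ha' hb'.
Proof.
  intros H. unfold corner. rewrite (cross_anti b a), (dot_comm b a).
  assert (cross a b <> 0) by exact H.
  assert (dot a a <> 0) by (apply Rgt_not_eq, (dot_self_pos a b H)).
  assert (dot b b <> 0).
  { apply Rgt_not_eq, (dot_self_pos b a). rewrite cross_anti. lra. }
  field. repeat split; assumption.
Qed.

(* Up to the factor [-1/2], this is the area of the triangle cut out by three lines. *)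
Lemma corner_triangle a b c ha hb hc ha' hb' hc' :
  cross a b <> 0 -> cross b c <> 0 -> cross c a <> 0 ->
  corner a b ha hb ha' hb' + corner b c hb hc hb' hc' + corner c a hc ha hc' ha' =
  - / (cross a b * cross b c * cross c a) *
    ((ha * cross b c + hb * cross c a + hc * cross a b) *
     (ha' * cross b c + hb' * cross c a + hc' * cross a b)).
Proof.
  intros Hab Hbc Hca.
  assert (Ha := dot_self_pos a b Hab). assert (Hb := dot_self_pos b c Hbc).
  assert (Hc := dot_self_pos c a Hca).
  destruct a as [a1 a2], b as [b1 b2], c as [c1 c2].
  unfold corner, cross, dot in *; simpl in *.
  field. repeat split; lra.
Qed.

(** Both points [p] satisfy [cross b p = hb], so their cross product is [hb / dot b b] times the
    difference of their dot products with [b]. Each of these depends on one corner only. *)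
Lemma cross_line_meet a b c ha hb hc :
  cross a b <> 0 -> cross b c <> 0 ->
  cross (line_meet a ha b hb) (line_meet b hb c hc) =
  hb * (ha - hb * dot a b / dot b b) / cross a b +
  - (hb * (hb * dot b c / dot b b - hc) / cross b c).
Proof.
  intros Hab Hbc. assert (Hb := dot_self_pos b c Hbc).
  destruct a as [a1 a2], b as [b1 b2], c as [c1 c2].
  unfold line_meet, cross, dot in *; simpl in *. field. repeat split; lra.
Qed.

(** By Lagrange's identity [vnorm w * vnorm d] is the absolute value of [dot w d] when the two are
    parallel. A side of length zero causes no trouble, since its sign multiplies zero. This makes
    the perimeter linear in the offsets. *)
Lemma signed_len_parallel w d :
  cross w d = 0 -> 0 < vnorm d -> signed_len w d = dot w d / vnorm d.
Proof.
  intros Hc Hd. unfold signed_len.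
  assert (E : dot w d * dot w d = (vnorm w * vnorm d) * (vnorm w * vnorm d)).
  { replace (vnorm w * vnorm d * (vnorm w * vnorm d))
      with ((vnorm w * vnorm w) * (vnorm d * vnorm d)) by ring.
    rewrite !vnorm_sqr.
    replace (dot w w * dot d d) with (dot w d * dot w d + cross w d * cross w d)
      by (unfold dot, cross; ring).
    rewrite Hc. ring. }
  assert (Hw : 0 <= vnorm w) by apply sqrt_pos.
  assert (Hwd : 0 <= vnorm w * vnorm d) by (apply Rmult_le_pos; lra).
  apply Rmult_eq_reg_r with (vnorm d); [|lra].
  unfold Rdiv. rewrite !Rmult_assoc, Rinv_l, Rmult_1_r by lra.
  destruct (Rlt_dec 0 (dot w d)); nra.
Qed.

Lemma side_signed_len a b c ha hb hc :
  cross a b <> 0 -> cross b c <> 0 ->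
  signed_len (vsub (line_meet b hb c hc) (line_meet a ha b hb)) b =
  (hb * dot a b / vnorm b - vnorm b * ha) / cross a b +
  (hb * dot b c / vnorm b - vnorm b * hc) / cross b c.
Proof.
  intros Hab Hbc. assert (Hb := vnorm_pos b c Hbc). assert (Eb := vnorm_sqr b).
  rewrite signed_len_parallel.
  - transitivity ((hb * dot a b / vnorm b - dot b b / vnorm b * ha) / cross a b +
      (hb * dot b c / vnorm b - dot b b / vnorm b * hc) / cross b c).
    (* The norm is treated as an independent variable for [field]; its relation [Eb] to [dot b b]
       enters only in the other half of the [transitivity]. *)
    + clear Eb. set (rho := vnorm b) in *. clearbody rho.
      destruct a as [a1 a2], b as [b1 b2], c as [c1 c2].
      unfold line_meet, vsub, cross, dot in *; simpl in *. field. repeat split; lra.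
    + rewrite <- Eb. field. repeat split; lra.
  - destruct a as [a1 a2], b as [b1 b2], c as [c1 c2].
    unfold line_meet, vsub, cross in *; simpl in *. field. repeat split; lra.
  - exact Hb.
Qed.

(** * Diagonalisation over the fan of triangles *)

(** The determinant with rows the offsets and the two coordinates of the directions of the lines
    [0], [k+1], [k+2]; it vanishes exactly when these pairwise non-parallel lines are concurrent. *)
Definition fan_form (s : nat -> vec) (k : nat) (h : nat -> R) : R :=
  h 0%nat * cross (s (S k)) (s (S (S k))) + h (S k) * cross (s (S (S k))) (s 0%nat) +
  h (S (S k)) * cross (s 0%nat) (s (S k)).

(** The signed area of the triangle is the square of [fan_form] over twice this product, so its sign
    is fixed by the directions alone. *)
Definition fan_orient (s : nat -> vec) (k : nat) : R :=
  cross (s 0%nat) (s (S k)) * cross (s (S k)) (s (S (S k))) * cross (s (S (S k))) (s 0%nat).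

Definition fan_bil (s : nat -> vec) (n : nat) : (nat -> R) -> (nat -> R) -> R :=
  diag_form (n - 2) (fun k => - / fan_orient s k) (fan_form s).

Lemma fan_orient_neq0 s n k :
  pairwise_nonparallel s n -> (k < n - 2)%nat -> fan_orient s k <> 0.
Proof.
  intros HP Hk. unfold fan_orient.
  repeat apply Rmult_integral_contrapositive_currified; apply HP; lia.
Qed.

Lemma fan_bil_corners s n h h' :
  (3 <= n)%nat -> pairwise_nonparallel s n ->
  rsum n (fun i => corner (s i) (s (nxt n i)) (h i) (h (nxt n i)) (h' i) (h' (nxt n i))) =
  fan_bil s n h h'.
Proof.
  intros Hn HP.
  rewrite (rsum_cycle_fan n (fun i j => corner (s i) (s j) (h i) (h j) (h' i) (h' j))).
  - apply rsum_ext. intros k Hk. apply corner_triangle; apply HP; lia.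
  - lia.
  - intros k Hk. apply corner_anti. apply HP; lia.
Qed.

Lemma area_fan_bil s n h :
  (3 <= n)%nat -> pairwise_nonparallel s n -> area s n h = - / 2 * fan_bil s n h h.
Proof.
  intros Hn HP. rewrite <- fan_bil_corners by assumption. unfold area.
  (* [out j] is the share of the side on line [j] at its final corner. Side number [i] lies on line
     [nxt n i], so its share is [out (nxt n i)]; the cyclic shift brings it to the corner where it
     belongs. *)
  pose (out := fun j => - (h j * (h j * dot (s j) (s (nxt n j)) / dot (s j) (s j) - h (nxt n j))
      / cross (s j) (s (nxt n j)))).
  rewrite (rsum_ext n _ (fun i =>
    h (nxt n i) * (h i - h (nxt n i) * dot (s i) (s (nxt n i)) / dot (s (nxt n i)) (s (nxt n i)))
      / cross (s i) (s (nxt n i)) + out (nxt n i))).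
  - rewrite rsum_plus, (rsum_nxt n out), <- rsum_plus.
    rewrite <- !rsum_scal.
    apply rsum_ext. intros i Hi. unfold corner, out.
    assert (0 < dot (s i) (s i)) by (apply (nonparallel_dot_pos s n); assumption).
    assert (0 < dot (s (nxt n i)) (s (nxt n i)))
      by (apply (nonparallel_dot_pos s n); try apply nxt_lt; lia || assumption).
    assert (cross (s i) (s (nxt n i)) <> 0).
    { apply HP; [assumption|apply nxt_lt; lia|]. apply not_eq_sym, nxt_neq; lia. }
    field. repeat split; lra.
  - intros i Hi. assert (nxt n i < n)%nat by (apply nxt_lt; lia).
    apply cross_line_meet; apply HP; try assumption; try (apply nxt_lt; lia);
      apply not_eq_sym, nxt_neq; lia.
Qed.

(** The offsets [vnorm (s i)] describe the polygon of signed radius [-1] about the origin; the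
    perimeter is a mixed area with it, up to a constant factor. *)
Lemma perimeter_fan_bil s n w :
  (3 <= n)%nat -> pairwise_nonparallel s n ->
  perimeter s n w = fan_bil s n (fun i => vnorm (s i)) w.
Proof.
  intros Hn HP. rewrite <- fan_bil_corners by assumption. unfold perimeter.
  pose (out := fun j => (w j * dot (s j) (s (nxt n j)) / vnorm (s j) - vnorm (s j) * w (nxt n j))
      / cross (s j) (s (nxt n j))).
  rewrite (rsum_ext n _ (fun i =>
    (w (nxt n i) * dot (s i) (s (nxt n i)) / vnorm (s (nxt n i)) - vnorm (s (nxt n i)) * w i)
      / cross (s i) (s (nxt n i)) + out (nxt n i))).
  - rewrite rsum_plus, (rsum_nxt n out), <- rsum_plus.
    apply rsum_ext. intros i Hi. unfold corner, out.
    assert (0 < vnorm (s i)) by (apply (nonparallel_vnorm_pos s n); assumption).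
    assert (0 < vnorm (s (nxt n i)))
      by (apply (nonparallel_vnorm_pos s n); try apply nxt_lt; lia || assumption).
    assert (cross (s i) (s (nxt n i)) <> 0).
    { apply HP; [assumption|apply nxt_lt; lia|]. apply not_eq_sym, nxt_neq; lia. }
    rewrite <- !vnorm_sqr. field. repeat split; lra.
  - intros i Hi. assert (nxt n i < n)%nat by (apply nxt_lt; lia).
    apply side_signed_len; apply HP; try assumption; try (apply nxt_lt; lia);
      apply not_eq_sym, nxt_neq; lia.
Qed.

Lemma fan_form_linear s k : linear_form (fan_form s k).
Proof. unfold fan_form. split; intros; ring. Qed.

Lemma fan_form_ext s n k h h' :
  (k < n - 2)%nat -> (forall i, (i < n)%nat -> h i = h' i) -> fan_form s k h = fan_form s k h'.
Proof. intros Hk H. unfold fan_form. rewrite !H by lia. reflexivity. Qed.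

Lemma fan_bil_linear s n h : linear_form (fan_bil s n h).
Proof. apply diag_form_linear. intros. apply fan_form_linear. Qed.

Lemma fan_bil_sym s n h h' : fan_bil s n h h' = fan_bil s n h' h.
Proof. apply diag_form_sym. Qed.

Lemma fan_bil_ext s n h1 h2 h1' h2' :
  (forall i, (i < n)%nat -> h1 i = h2 i) -> (forall i, (i < n)%nat -> h1' i = h2' i) ->
  fan_bil s n h1 h1' = fan_bil s n h2 h2'.
Proof.
  intros H H'. apply rsum_ext. intros k Hk.
  rewrite (fan_form_ext s n k h1 h2 Hk H), (fan_form_ext s n k h1' h2' Hk H'). reflexivity.
Qed.

Lemma fan_bil_square_plus s n v w a b :
  fan_bil s n (fun i => a * v i + b * w i) (fun i => a * v i + b * w i) =
  a * a * fan_bil s n v v + 2 * a * b * fan_bil s n w v + b * b * fan_bil s n w w.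
Proof.
  unfold fan_bil, diag_form. rewrite <- !rsum_scal, <- !rsum_plus.
  apply rsum_ext. intros k Hk. unfold fan_form. ring.
Qed.

(** Translates the lines from [k+2] on parallel to [s 0] and fixes the others; line [0] is preserved
    by such a translation in any case. Triangles before [k] do not move, those after [k] move
    rigidly, and the scaling makes [fan_form s k] equal to [1]. *)
Definition fan_dual (s : nat -> vec) (k i : nat) : R :=
  if le_dec i (S k) then 0
  else cross (s 0%nat) (s i) / (cross (s 0%nat) (s (S k)) * cross (s 0%nat) (s (S (S k)))).

Lemma fan_form_dual s n j k :
  pairwise_nonparallel s n -> (j < n - 2)%nat -> (k < n - 2)%nat ->
  fan_form s j (fan_dual s k) = if Nat.eq_dec j k then 1 else 0.
Proof.
  intros HP Hj Hk. unfold fan_form, fan_dual.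
  assert (cross (s 0%nat) (s (S k)) <> 0) by (apply HP; lia).
  assert (cross (s 0%nat) (s (S (S k))) <> 0) by (apply HP; lia).
  destruct (le_dec 0 (S k)); [|lia].
  destruct (le_dec (S j) (S k)), (le_dec (S (S j)) (S k)), (Nat.eq_dec j k); try lia.
  - ring.
  - subst j. field. split; assumption.
  - rewrite (cross_anti (s (S (S j)))). field. split; assumption.
Qed.

(** The condition [v i = cross (s i) t] says that line [i] passes through [t]. Taking [t] on lines
    [0] and [1], concurrency of successive fan triples carries it to all the lines. *)
Lemma fan_form_kernel s n v :
  (3 <= n)%nat -> pairwise_nonparallel s n ->
  (forall k, (k < n - 2)%nat -> fan_form s k v = 0) -> translation_vec s n v.
Proof.
  intros Hn HP Hv.
  assert (H01 : cross (s 0%nat) (s 1%nat) <> 0) by (apply HP; lia).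
  exists (line_meet (s 0%nat) (v 0%nat) (s 1%nat) (v 1%nat)).
  set (t := line_meet _ _ _ _).
  assert (E0 : v 0%nat = cross (s 0%nat) t).
  { unfold t, line_meet, cross in *; simpl. field. exact H01. }
  assert (E1 : v 1%nat = cross (s 1%nat) t).
  { unfold t, line_meet, cross in *; simpl. field. exact H01. }
  intros i Hi. destruct i as [|i]; [exact E0|].
  induction i as [|i IH]; [exact E1|].
  assert (Hk := Hv i ltac:(lia)). specialize (IH ltac:(lia)).
  unfold fan_form in Hk. rewrite E0, IH in Hk.
  assert (Hc : cross (s 0%nat) (s (S i)) <> 0) by (apply HP; lia).
  apply Rmult_eq_reg_r with (cross (s 0%nat) (s (S i))); [|exact Hc].
  apply Rminus_diag_uniq. rewrite <- Hk. unfold cross. ring.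
Qed.

(** * The Hessian of the perimeter *)

Lemma tangential_offset s n h r i :
  (3 <= n)%nat -> pairwise_nonparallel s n -> Tangential s n h (0, 0) r ->
  (i < n)%nat -> h i = - r * vnorm (s i).
Proof.
  intros Hn HP [_ HT] Hi. rewrite <- (HT i Hi). unfold signed_dist.
  assert (0 < vnorm (s i)) by (apply (nonparallel_vnorm_pos s n); assumption).
  unfold cross; simpl. field. lra.
Qed.

(** The offsets of a tangential polygon are [- r] times those that represent the perimeter, so the
    differentials of area and perimeter at [h] are proportional. *)
Lemma tangential_fan_bil s n h r w :
  (3 <= n)%nat -> pairwise_nonparallel s n -> Tangential s n h (0, 0) r ->
  fan_bil s n h w = - r * perimeter s n w.
Proof.
  intros Hn HP HT. rewrite perimeter_fan_bil by assumption.
  rewrite (fan_bil_ext s n h (fun i => - r * vnorm (s i)) w w).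
  - unfold fan_bil, diag_form. rewrite <- rsum_scal. apply rsum_ext.
    intros k Hk. unfold fan_form. ring.
  - intros i Hi. apply (tangential_offset s n h r); assumption.
  - reflexivity.
Qed.

(** * Differentiation along curves of polygons *)

Lemma derivable_pt_lim_rsum (k : nat) (f : nat -> R -> R) (l : nat -> R) (t : R) :
  (forall i, (i < k)%nat -> derivable_pt_lim (f i) t (l i)) ->
  derivable_pt_lim (fun u => rsum k (fun i => f i u)) t (rsum k l).
Proof.
  induction k as [|k IH]; intros H; simpl.
  - apply derivable_pt_lim_const.
  - apply (derivable_pt_lim_plus (fun u => rsum k (fun i => f i u)) (f k)).
    + apply IH. intros; apply H; lia.
    + apply H; lia.
Qed.

Definition derivable_below (n : nat) (g : curve) (t : R) (d : nat -> R) : Prop :=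
  forall i, (i < n)%nat -> derivable_pt_lim (fun u => g u i) t (d i).

Lemma derivable_below_fan_form s n k g t d :
  (k < n - 2)%nat -> derivable_below n g t d ->
  derivable_pt_lim (fun u => fan_form s k (g u)) t (fan_form s k d).
Proof.
  intros Hk Hg. unfold fan_form.
  assert (Hs : forall i x, (i < n)%nat ->
    derivable_pt_lim (fun u => g u i * x) t (d i * x)).
  { intros i x Hi. apply is_derive_Reals.
    apply (is_derive_scal_l (fun u => g u i) t (d i) x).
    apply is_derive_Reals, Hg, Hi. }
  apply (derivable_pt_lim_plus
    (fun u => g u 0%nat * _ + g u (S k) * _) (fun u => g u (S (S k)) * _)).
  - apply (derivable_pt_lim_plus (fun u => g u 0%nat * _) (fun u => g u (S k) * _));
      apply Hs; lia.
  - apply Hs; lia.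
Qed.

Lemma derivable_below_fan_bil s n g g' t d d' :
  derivable_below n g t d -> derivable_below n g' t d' ->
  derivable_pt_lim (fun u => fan_bil s n (g u) (g' u)) t
    (fan_bil s n d (g' t) + fan_bil s n (g t) d').
Proof.
  intros Hg Hg'. unfold fan_bil, diag_form. rewrite <- rsum_plus.
  apply (derivable_pt_lim_rsum (n - 2)
    (fun k u => - / fan_orient s k * (fan_form s k (g u) * fan_form s k (g' u)))).
  intros k Hk. rewrite <- Rmult_plus_distr_l.
  apply (derivable_pt_lim_scal (fun u => fan_form s k (g u) * fan_form s k (g' u))).
  apply (derivable_pt_lim_mult (fun u => fan_form s k (g u)) (fun u => fan_form s k (g' u)));
    apply (derivable_below_fan_form s n); assumption.
Qed.

Lemma derivable_below_perimeter s n g t d :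
  (3 <= n)%nat -> pairwise_nonparallel s n -> derivable_below n g t d ->
  derivable_pt_lim (fun u => perimeter s n (g u)) t (perimeter s n d).
Proof.
  intros Hn HP Hg. rewrite perimeter_fan_bil by assumption.
  replace (fun u => perimeter s n (g u))
    with (fun u => fan_bil s n (fun i => vnorm (s i)) (g u)).
  2:{ extensionality u. symmetry. apply perimeter_fan_bil; assumption. }
  rewrite <- (Rplus_0_l (fan_bil s n _ d)).
  rewrite <- (proj1 (fan_bil_linear s n (g t))), (fan_bil_sym s n (g t)).
  apply (derivable_below_fan_bil s n (fun _ i => vnorm (s i)) g t (fun _ => 0) d); [|exact Hg].
  intros i Hi. apply derivable_pt_lim_const.
Qed.

(* Since [area] takes only the values [1] and [-1] along the curve, [area ^ 2] is
   constant; differentiating it avoids an intermediate value argument. *)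
Lemma admissible_derivatives s n h g :
  (3 <= n)%nat -> pairwise_nonparallel s n -> admissible s n h g ->
  exists (d : curve) (a : nat -> R),
    (forall t, derivable_below n g t (d t)) /\ derivable_below n d 0 a /\
    fan_bil s n h (d 0) = 0 /\ fan_bil s n (d 0) (d 0) + fan_bil s n h a = 0.
Proof.
  intros Hn HP [HC [H0 HA]].
  destruct (finite_choice (R -> R) (fun _ => 0) _ n HC) as [d Hd].
  destruct (finite_choice R 0 (fun i a => derivable_pt_lim (d i) 0 a) n) as [a Ha].
  { intros i Hi. apply (Hd i Hi). }
  assert (D1 : forall t, derivable_below n g t (fun i => d i t))
    by (intros t i Hi; apply (Hd i Hi)).
  assert (Horth : forall t, fan_bil s n (g t) (fun i => d i t) = 0).
  { intros t. set (F := fun u => fan_bil s n (g u) (g u)).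
    (* The area is [- F / 2] and has absolute value [1]. Then [2 * F * F' = 0] with [F] nonzero
       forces [F' = 0]. *)
    assert (HF : forall u, F u * F u = 4).
    { intros u. specialize (HA u). rewrite area_fan_bil in HA by assumption. fold (F u) in HA.
      assert (Rsqr (Rabs (- / 2 * F u)) = Rsqr 1) by (rewrite HA; reflexivity).
      rewrite <- Rsqr_abs in H. unfold Rsqr in H. lra. }
    assert (DF := derivable_below_fan_bil s n g g t _ _ (D1 t) (D1 t)). fold F in DF.
    assert (DFF := derivable_pt_lim_mult F F t _ _ DF DF).
    replace (mult_fct F F) with (fct_cte 4) in DFF
      by (extensionality u; symmetry; apply HF).
    assert (E := uniqueness_limite _ _ _ _ DFF (derivable_pt_lim_const 4 t)).
    rewrite (fan_bil_sym s n _ (g t)) in E. specialize (HF t).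
    assert (F t <> 0) by (intros Z; rewrite Z in HF; lra).
    assert (E' : F t * fan_bil s n (g t) (fun i => d i t) = 0) by lra.
    apply Rmult_integral in E'. tauto. }
  exists (fun t i => d i t), a. repeat split.
  - exact D1.
  - exact Ha.
  - transitivity (fan_bil s n (g 0) (fun i => d i 0)); [|apply Horth].
    apply fan_bil_ext; [|reflexivity].
    intros i Hi. symmetry. apply H0, Hi.
  (* Differentiating the orthogonality relation [Horth] once more at [0]. *)
  - assert (D2 := derivable_below_fan_bil s n g (fun t i => d i t) 0 _ a (D1 0) Ha).
    simpl in D2.
    replace (fun u => fan_bil s n (g u) (fun i => d i u)) with (fct_cte 0) in D2
      by (extensionality u; symmetry; apply Horth).
    assert (E := uniqueness_limite _ _ _ _ D2 (derivable_pt_lim_const 0 0)).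
    rewrite (fan_bil_ext s n h (g 0) a a); [exact E| |reflexivity].
    intros i Hi. symmetry. apply H0, Hi.
Qed.

Lemma velocity_orthogonal s n h g v :
  (3 <= n)%nat -> pairwise_nonparallel s n ->
  admissible s n h g -> velocity n g v -> fan_bil s n h v = 0.
Proof.
  intros Hn HP Hg Hv. destruct (admissible_derivatives s n h g Hn HP Hg) as [d [a [D1 [_ [E _]]]]].
  rewrite <- E. apply fan_bil_ext; [reflexivity|]. intros i Hi.
  exact (uniqueness_limite _ _ _ _ (Hv i Hi) (D1 0 i Hi)).
Qed.

(** By linearity the second derivative is the perimeter of the acceleration. The twice
    differentiated area constraint expresses it through the velocity, so it is the same for all
    curves with velocity [v]. *)
Lemma perimeter_second_derivative s n h r g v :
  (3 <= n)%nat -> pairwise_nonparallel s n -> Tangential s n h (0, 0) r ->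
  admissible s n h g -> velocity n g v ->
  SecondDeriv (fun t => perimeter s n (g t)) (fan_bil s n v v / r).
Proof.
  intros Hn HP HT Hg Hv.
  destruct (admissible_derivatives s n h g Hn HP Hg) as [d [a [D1 [D2 [_ E]]]]].
  exists (fun t => perimeter s n (d t)). split.
  - intros t. apply derivable_below_perimeter; auto.
  - replace (fan_bil s n v v / r) with (perimeter s n a).
    + apply derivable_below_perimeter; assumption.
    + rewrite (fan_bil_ext s n v (d 0) v (d 0)).
      * rewrite (tangential_fan_bil s n h r a Hn HP HT) in E.
        replace (fan_bil s n (d 0) (d 0)) with (r * perimeter s n a) by lra.
        field. apply HT.
      * intros i Hi. exact (uniqueness_limite _ _ _ _ (Hv i Hi) (D1 0 i Hi)).
      * intros i Hi. exact (uniqueness_limite _ _ _ _ (Hv i Hi) (D1 0 i Hi)).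
Qed.

(** * Tangent vectors, nondegeneracy and the index *)

Lemma SecondDeriv_unique f c c' : SecondDeriv f c -> SecondDeriv f c' -> c = c'.
Proof.
  intros [f1 [H1 H2]] [f1' [H1' H2']].
  assert (E : f1 = f1').
  { extensionality t. exact (uniqueness_limite _ _ _ _ (H1 t) (H1' t)). }
  subst f1'. exact (uniqueness_limite _ _ _ _ H2 H2').
Qed.

(** A global parametrization of the branch of [x^2 + beta * y^2 = 1] through [(1, 0)] with initial
    velocity [(0, 1)]: hyperbolic, affine or trigonometric according to the sign of [beta]. *)
Lemma conic_parametrization (beta : R) :
  exists a b a1 b1 : R -> R,
    (forall t, a t * a t + beta * (b t * b t) = 1) /\
    a 0 = 1 /\ b 0 = 0 /\ a1 0 = 0 /\ b1 0 = 1 /\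
    (forall t, derivable_pt_lim a t (a1 t)) /\ (forall t, derivable_pt_lim b t (b1 t)) /\
    (exists a2, derivable_pt_lim a1 0 a2) /\ (exists b2, derivable_pt_lim b1 0 b2).
Proof.
  destruct (total_order_T beta 0) as [[Hlt|Heq]|Hgt].
  - set (k := sqrt (- beta)).
    assert (Hk : 0 < k) by (apply sqrt_lt_R0; lra).
    assert (Ek : beta = - (k * k)) by (unfold k; rewrite sqrt_sqrt; lra).
    clearbody k. subst beta.
    exists (fun t => (exp (k * t) + exp (- (k * t))) / 2),
           (fun t => (exp (k * t) - exp (- (k * t))) / (2 * k)),
           (fun t => k * ((exp (k * t) - exp (- (k * t))) / 2)),
           (fun t => (exp (k * t) + exp (- (k * t))) / 2).
    repeat split.
    + intros t. rewrite exp_Ropp. assert (exp (k * t) <> 0) by (apply Rgt_not_eq, exp_pos).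
      field. split; lra.
    + rewrite Rmult_0_r, Ropp_0, exp_0. lra.
    + rewrite Rmult_0_r, Ropp_0, exp_0. field; lra.
    + rewrite Rmult_0_r, Ropp_0, exp_0. lra.
    + rewrite Rmult_0_r, Ropp_0, exp_0. lra.
    + intros t. apply is_derive_Reals. auto_derive; [exact I|field].
    + intros t. apply is_derive_Reals. auto_derive; [exact I|field; lra].
    + eexists. apply is_derive_Reals. auto_derive; [exact I|reflexivity].
    + eexists. apply is_derive_Reals. auto_derive; [exact I|reflexivity].
  - subst beta. exists (fun _ => 1), (fun t => t), (fun _ => 0), (fun _ => 1).
    repeat split; try lra.
    + intros t. ring.
    + intros t. apply derivable_pt_lim_const.
    + intros t. apply derivable_pt_lim_id.
    + exists 0. apply derivable_pt_lim_const.
    + exists 0. apply derivable_pt_lim_const.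
  - set (k := sqrt beta).
    assert (Hk : 0 < k) by (apply sqrt_lt_R0; lra).
    assert (Ek : beta = k * k) by (unfold k; rewrite sqrt_sqrt; lra).
    clearbody k. subst beta.
    exists (fun t => cos (k * t)), (fun t => sin (k * t) / k),
           (fun t => - k * sin (k * t)), (fun t => cos (k * t)).
    repeat split.
    + intros t. rewrite <- (sin2_cos2 (k * t)). unfold Rsqr. field. lra.
    + rewrite Rmult_0_r. apply cos_0.
    + rewrite Rmult_0_r, sin_0. field. lra.
    + rewrite Rmult_0_r, sin_0. ring.
    + rewrite Rmult_0_r. apply cos_0.
    + intros t. apply is_derive_Reals. auto_derive; [exact I|ring].
    + intros t. apply is_derive_Reals. auto_derive; [exact I|field; lra].
    + eexists. apply is_derive_Reals. auto_derive; [exact I|reflexivity].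
    + eexists. apply is_derive_Reals. auto_derive; [exact I|reflexivity].
Qed.

(** For [v] orthogonal to [h], the form at [a * h + b * v] is
    [fan_bil s n h h * (a^2 + beta * b^2)], with [beta] the quotient of the values at [v] and [h].
    The conic above therefore gives a curve of constant area with velocity [v]. *)
Lemma tangentS_iff s n h v :
  (3 <= n)%nat -> pairwise_nonparallel s n -> Rabs (area s n h) = 1 ->
  tangentS s n h v <-> fan_bil s n h v = 0.
Proof.
  intros Hn HP HA. split.
  - intros [g [Hg Hv]]. exact (velocity_orthogonal s n h g v Hn HP Hg Hv).
  - intros Hv.
    assert (Hh : fan_bil s n h h <> 0).
    { intros E. rewrite area_fan_bil, E, Rmult_0_r, Rabs_R0 in HA by assumption. lra. }
    destruct (conic_parametrization (fan_bil s n v v / fan_bil s n h h))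
      as [a [b [a1 [b1 [Hab [a0 [b0 [a10 [b10 [Da [Db [[a2 Da1] [b2 Db1]]]]]]]]]]]]].
    assert (Hlin : forall (f g f1 g1 : R -> R) x y t,
      derivable_pt_lim f t (f1 t) -> derivable_pt_lim g t (g1 t) ->
      derivable_pt_lim (fun u => f u * x + g u * y) t (f1 t * x + g1 t * y)).
    { intros f g f1 g1 x y t Hf Hg. apply is_derive_Reals.
      apply (is_derive_plus (fun u => f u * x) (fun u => g u * y));
        apply (is_derive_scal_l (V := R_NormedModule)); apply is_derive_Reals; assumption. }
    exists (fun t i => a t * h i + b t * v i). split; [split; [|split]|].
    + intros i Hi. exists (fun t => a1 t * h i + b1 t * v i). split.
      * intros t. apply Hlin; auto.
      * exists (a2 * h i + b2 * v i).
        apply (Hlin a1 b1 (fun _ => a2) (fun _ => b2)); assumption.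
    + intros i Hi. rewrite a0, b0. ring.
    + intros t. rewrite <- HA, !area_fan_bil by assumption.
      rewrite fan_bil_square_plus, (fan_bil_sym s n v h), Hv.
      do 2 f_equal. rewrite <- (Rmult_1_r (fan_bil s n h h)) at 2.
      rewrite <- (Hab t). field. exact Hh.
    + intros i Hi. replace (v i) with (a1 0 * h i + b1 0 * v i) by (rewrite a10, b10; ring).
      replace (fun t => a t * h i + b t * (a1 0 * h i + b1 0 * v i))
        with (fun t => a t * h i + b t * v i) by (extensionality t; rewrite a10, b10; ring).
      apply Hlin; auto.
Qed.

Lemma hess_neg_iff s n h r v :
  (3 <= n)%nat -> pairwise_nonparallel s n -> Rabs (area s n h) = 1 ->
  Tangential s n h (0, 0) r ->
  hess_neg s n h v <-> fan_bil s n h v = 0 /\ fan_bil s n v v / r < 0.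
Proof.
  intros Hn HP HA HT. unfold hess_neg. rewrite tangentS_iff by assumption. split.
  - intros [Hv Hneg]. split; [exact Hv|].
    apply (tangentS_iff s n h v Hn HP HA) in Hv as [g [Hg Hgv]].
    apply (Hneg g _ Hg Hgv). apply (perimeter_second_derivative s n h r); assumption.
  - intros [Hv Hneg]. split; [exact Hv|]. intros g c Hg Hgv Hc.
    rewrite (SecondDeriv_unique _ _ _ Hc
      (perimeter_second_derivative s n h r g v Hn HP HT Hg Hgv)). exact Hneg.
Qed.

Lemma tangential_critical s n h r :
  (3 <= n)%nat -> pairwise_nonparallel s n -> Tangential s n h (0, 0) r -> CriticalS s n h.
Proof.
  intros Hn HP HT g c Hg Hc.
  destruct (admissible_derivatives s n h g Hn HP Hg) as [d [a [D1 [_ [E _]]]]].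
  rewrite (uniqueness_limite _ _ _ _ Hc (derivable_below_perimeter s n g 0 _ Hn HP (D1 0))).
  rewrite (tangential_fan_bil s n h r _ Hn HP HT) in E.
  destruct HT as [Hr _]. apply Rmult_integral in E. lra.
Qed.

(** A degenerate tangent vector is orthogonal to the complement of [h] and, being tangent, to [h]
    itself. It thus lies in the radical of the form, which consists of translations. *)
Lemma tangential_nondegenerate s n h r :
  (3 <= n)%nat -> pairwise_nonparallel s n -> Rabs (area s n h) = 1 ->
  Tangential s n h (0, 0) r -> NondegS s n h.
Proof.
  intros Hn HP HA HT v Tv Hpol.
  assert (Hv := proj1 (tangentS_iff s n h v Hn HP HA) Tv).
  assert (Hr : r <> 0) by apply HT.
  assert (Hlin := fan_bil_linear s n).
  assert (Horth : forall v', fan_bil s n h v' = 0 -> fan_bil s n v v' = 0).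
  { intros v' Hv'.
    assert (Tv' := proj2 (tangentS_iff s n h v' Hn HP HA) Hv').
    assert (Tvv' : tangentS s n h (fun i => v i + v' i)).
    { apply tangentS_iff; try assumption.
      replace (fun i => v i + v' i) with (fun i => v i + 1 * v' i)
        by (extensionality i; ring).
      rewrite (proj2 (Hlin h)), Hv, Hv'. ring. }
    destruct Tvv' as [g1 [A1 V1]], Tv as [g2 [A2 V2]].
    assert (Tv3 := Tv'). destruct Tv3 as [g3 [A3 V3]].
    (* Polarization of the second derivatives leaves [2 * fan_bil s n v v' / r]. *)
    assert (E := Hpol v' Tv' g1 g2 g3 _ _ _ A1 V1 A2 V2 A3 V3
      (perimeter_second_derivative s n h r g1 _ Hn HP HT A1 V1)
      (perimeter_second_derivative s n h r g2 _ Hn HP HT A2 V2)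
      (perimeter_second_derivative s n h r g3 _ Hn HP HT A3 V3)).
    replace (fun i => v i + v' i) with (fun i => 1 * v i + 1 * v' i) in E
      by (extensionality i; ring).
    rewrite fan_bil_square_plus, (fan_bil_sym s n v' v) in E.
    assert (E' : 2 * fan_bil s n v v' / r = 0) by (rewrite <- E; field; exact Hr).
    unfold Rdiv in E'. apply Rmult_integral in E' as [E'|E']; [lra|].
    apply Rinv_neq_0_compat in Hr. lra. }
  assert (Hh : fan_bil s n h h <> 0).
  { intros E. rewrite area_fan_bil, E, Rmult_0_r, Rabs_R0 in HA by assumption. lra. }
  assert (Hall : forall x, fan_bil s n v x = 0).
  { intros x.
    assert (E : fan_bil s n v (fun i => x i + - (fan_bil s n h x / fan_bil s n h h) * h i) = 0).
    { apply Horth. rewrite (proj2 (Hlin h)). field. exact Hh. }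
    rewrite (proj2 (Hlin v)), (fan_bil_sym s n v h), Hv in E. lra. }
  (* Testing against the dual vector [fan_dual s k] isolates the coordinate [fan_form s k v]. *)
  apply fan_form_kernel; [assumption|assumption|]. intros k Hk.
  specialize (Hall (fan_dual s k)). unfold fan_bil, diag_form in Hall.
  rewrite (rsum_single _ k) in Hall.
  - rewrite (fan_form_dual s n) in Hall by assumption.
    destruct (Nat.eq_dec k k); [|lia]. rewrite Rmult_1_r in Hall.
    apply Rmult_integral in Hall as [Hall|Hall]; [|exact Hall].
    assert (Hx := Rinv_neq_0_compat _ (fan_orient_neq0 s n k HP Hk)). lra.
  - exact Hk.
  - intros i Hi Hne. rewrite (fan_form_dual s n) by assumption.
    destruct (Nat.eq_dec i k); [lia|ring].
Qed.

Lemma tangential_morse_index s n h r :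
  (3 <= n)%nat -> pairwise_nonparallel s n -> Rabs (area s n h) = 1 ->
  Tangential s n h (0, 0) r ->
  exists m, MorseIndex s n h m /\
    (m + (if Rlt_dec 0 (perimeter s n h) then 1 else 0)
       = count (fun k => is_neg (- (fan_orient s k * r))) (n - 2))%nat.
Proof.
  intros Hn HP HA HT. assert (Hr : r <> 0) by apply HT.
  (* The coefficients of the Hessian form. By [EP] below its value at [h] is [- perimeter s n h], so
     the square lost on the orthogonal of [h] is negative exactly when the perimeter is positive. *)
  pose (tau := fun k => - / fan_orient s k / r).
  assert (Hq : forall v w, diag_form (n - 2) tau (fan_form s) v w = fan_bil s n v w / r).
  { intros v w. unfold fan_bil, diag_form, Rdiv. rewrite Rmult_comm, <- rsum_scal.
    apply rsum_ext. intros k Hk. unfold tau. field.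
    split; [apply (fan_orient_neq0 s n k HP Hk)|exact Hr]. }
  assert (EP : fan_bil s n h h / r = - perimeter s n h).
  { rewrite (tangential_fan_bil s n h r h Hn HP HT). field. exact Hr. }
  assert (Hh : fan_bil s n h h <> 0).
  { intros E. rewrite area_fan_bil, E, Rmult_0_r, Rabs_R0 in HA by assumption. lra. }
  destruct (diag_form_orthogonal_index (n - 2) tau (fan_form s) (fan_dual s) h)
    as [m [Em [[w Hw] Hmax]]].
  - intros. apply fan_form_linear.
  - intros. apply (fan_form_dual s n); assumption.
  - rewrite Hq. apply Rmult_integral_contrapositive_currified;
      [exact Hh|apply Rinv_neq_0_compat, Hr].
  - assert (Hiff : forall v, hess_neg s n h v <->
      diag_form (n - 2) tau (fan_form s) h v = 0 /\
      diag_form (n - 2) tau (fan_form s) v v < 0).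
    { intros v. rewrite !Hq, (hess_neg_iff s n h r v Hn HP HA HT).
      split; intros [E1 E2]; (split; [|exact E2]).
      - rewrite E1. unfold Rdiv. ring.
      - replace (fan_bil s n h v) with (r * (fan_bil s n h v / r)) by (field; exact Hr).
        rewrite E1. ring. }
    exists m. split; [split|].
    + exists w. intros c Hc. apply Hiff, Hw, Hc.
    + intros K w' Hw'. apply Hmax with w'. intros c Hc. apply Hiff, Hw', Hc.
    + rewrite Hq, EP in Em.
      replace (if Rlt_dec 0 (perimeter s n h) then 1%nat else 0%nat)
        with (if Rlt_dec (- perimeter s n h) 0 then 1%nat else 0%nat).
      2:{ destruct (Rlt_dec (- perimeter s n h) 0), (Rlt_dec 0 (perimeter s n h));
            reflexivity || lra. }
      rewrite Em. apply count_ext. intros k Hk.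
      assert (HX := fan_orient_neq0 s n k HP Hk).
      assert (HX' : fan_orient s k * r <> 0)
        by (apply Rmult_integral_contrapositive_currified; assumption).
      unfold is_neg, tau.
      replace (- / fan_orient s k / r) with (- / (fan_orient s k * r))
        by (field; split; assumption).
      destruct (Rlt_dec 0 (fan_orient s k * r)) as [Hp|Hp].
      * assert (0 < / (fan_orient s k * r)) by (apply Rinv_0_lt_compat, Hp).
        destruct (Rlt_dec (- / (fan_orient s k * r)) 0), (Rlt_dec (- (fan_orient s k * r)) 0);
          reflexivity || lra.
      * assert (/ (fan_orient s k * r) < 0) by (apply Rinv_lt_0_compat; lra).
        destruct (Rlt_dec (- / (fan_orient s k * r)) 0), (Rlt_dec (- (fan_orient s k * r)) 0);
          reflexivity || lra.
Qed.

(** * Turns and winding number *)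

(** [atan] recovers an angle only modulo [PI]; the signs of sine and cosine locate the quadrant and
    hence the shift made by [atan2]. *)
Lemma atan2_polar (rho t : R) :
  0 < rho -> - PI < t < PI -> atan2 (rho * sin t) (rho * cos t) = t.
Proof.
  intros Hrho [Ht1 Ht2]. unfold atan2. assert (HPI := PI_RGT_0).
  assert (Etan : cos t <> 0 -> rho * sin t / (rho * cos t) = tan t).
  { intros Hc. unfold tan. field. split; lra. }
  destruct (Rlt_dec 0 (rho * cos t)) as [Hp|Hp].
  - assert (Hc : 0 < cos t) by nra.
    rewrite Etan by lra. apply atan_tan. split.
    + apply Rnot_le_lt. intros Hle.
      assert (cos (- t) <= 0) by (apply cos_le_0; lra). rewrite cos_neg in *. lra.
    + apply Rnot_le_lt. intros Hle. assert (cos t <= 0) by (apply cos_le_0; lra). lra.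
  - destruct (Rlt_dec (rho * cos t) 0) as [Hn|Hn].
    + assert (Hc : cos t < 0) by nra. rewrite Etan by lra.
      destruct (Rle_dec 0 (rho * sin t)) as [Hs|Hs].
      * assert (0 <= sin t) by nra.
        assert (0 <= t).
        { apply Rnot_lt_le. intros H0.
          assert (0 < sin (- t)) by (apply sin_gt_0; lra). rewrite sin_neg in *. lra. }
        assert (PI / 2 < t).
        { apply Rnot_le_lt. intros H2. assert (0 <= cos t) by (apply cos_ge_0; lra). lra. }
        replace (tan t) with (tan (t - PI)).
        -- rewrite atan_tan by lra. ring.
        -- unfold tan. rewrite sin_minus, cos_minus, sin_PI, cos_PI. field. lra.
      * assert (sin t < 0) by nra.
        assert (t < 0).
        { apply Rnot_le_lt. intros H0.
          assert (0 <= sin t) by (apply sin_ge_0; lra). lra. }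
        assert (t < - (PI / 2)).
        { apply Rnot_le_lt. intros H2. assert (0 <= cos t) by (apply cos_ge_0; lra). lra. }
        replace (tan t) with (tan (t + PI)).
        -- rewrite atan_tan by lra. ring.
        -- unfold tan. rewrite sin_plus, cos_plus, sin_PI, cos_PI. field. lra.
    + assert (Hc : cos t = 0) by nra.
      destruct (Rlt_le_dec t 0) as [H0|H0].
      * assert (0 < sin (- t)) by (apply sin_gt_0; lra). rewrite sin_neg in *.
        destruct (Rlt_dec 0 (rho * sin t)); [nra|].
        destruct (Rlt_dec (rho * sin t) 0); [|nra].
        apply Rle_antisym; apply Rnot_lt_le; intros H2.
        -- assert (cos (- t) < 0) by (apply cos_lt_0; lra). rewrite cos_neg in *. lra.
        -- assert (0 < cos t) by (apply cos_gt_0; lra). lra.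
      * destruct (Rle_lt_or_eq_dec 0 t H0) as [H1|<-]; [|rewrite cos_0 in Hc; lra].
        assert (0 < sin t) by (apply sin_gt_0; lra).
        destruct (Rlt_dec 0 (rho * sin t)); [|nra].
        apply Rle_antisym; apply Rnot_lt_le; intros H2.
        -- assert (0 < cos t) by (apply cos_gt_0; lra). lra.
        -- assert (cos t < 0) by (apply cos_lt_0; lra). lra.
Qed.

(** Since [y] is nonzero, the angle can be measured from the vertical axis as [atan (x / y)], with
    no case distinction on [x]. *)
Lemma polar_coordinates (x y : R) :
  y <> 0 ->
  exists rho t, 0 < rho /\ - PI < t < PI /\ x = rho * cos t /\ y = rho * sin t /\
    (0 < y -> 0 < t) /\ (y < 0 -> t < 0).
Proof.
  intros Hy. assert (HPI := PI_RGT_0).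
  assert (Hw := atan_bound (x / y)). assert (Ew := tan_atan (x / y)).
  set (w := atan (x / y)) in *.
  assert (Hc : 0 < cos w) by (apply cos_gt_0; lra).
  assert (Ex : x = y * sin w / cos w).
  { unfold tan in Ew. unfold Rdiv in *. rewrite Rmult_assoc, Ew. field. exact Hy. }
  destruct (Rlt_le_dec 0 y) as [H|H].
  - exists (y / cos w), (PI / 2 - w). rewrite cos_shift, sin_shift.
    repeat split; try lra.
    + apply Rdiv_lt_0_compat; assumption.
    + field. lra.
  - exists (- y / cos w), (- (PI / 2 + w)). rewrite cos_neg, sin_neg.
    replace (PI / 2 + w) with (PI / 2 - - w) by ring.
    rewrite cos_shift, sin_shift, sin_neg, cos_neg.
    repeat split; try lra.
    + apply Rdiv_lt_0_compat; lra.
    + field. lra.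
Qed.

Lemma angle_polar (a b : vec) (rho t : R) :
  0 < rho -> - PI < t < PI -> dot a b = rho * cos t -> cross a b = rho * sin t ->
  angle a b = t.
Proof. intros H1 H2 H3 H4. unfold angle. rewrite H3, H4. apply atan2_polar; assumption. Qed.

Lemma angle_spec (a b : vec) :
  cross a b <> 0 ->
  exists rho, 0 < rho /\ - PI < angle a b < PI /\
    dot a b = rho * cos (angle a b) /\ cross a b = rho * sin (angle a b) /\
    (0 < cross a b -> 0 < angle a b) /\ (cross a b < 0 -> angle a b < 0).
Proof.
  intros H. destruct (polar_coordinates (dot a b) (cross a b) H)
    as [rho [t [H1 [H2 [H3 [H4 H5]]]]]].
  rewrite (angle_polar a b rho t H1 H2 H3 H4). exists rho. auto.
Qed.

Lemma angle_anti (a b : vec) : cross a b <> 0 -> angle b a = - angle a b.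
Proof.
  intros H. destruct (angle_spec a b H) as [rho [H1 [H2 [H3 [H4 _]]]]].
  apply (angle_polar b a rho); [exact H1|lra| |].
  - rewrite dot_comm, cos_neg. exact H3.
  - rewrite cross_anti, sin_neg, H4. ring.
Qed.

(** * Turns of three directions *)

Lemma sin0_cos_pos (x : R) : sin x = 0 -> 0 < cos x -> - (2 * PI) < x < 2 * PI -> x = 0.
Proof.
  intros Hs Hc [H1 H2]. assert (HPI := PI_RGT_0).
  destruct (sin_eq_0_0 x Hs) as [k ->].
  assert (-2 < k < 2)%Z.
  { split; apply lt_IZR; apply Rmult_lt_reg_r with PI; lra. }
  assert (k = -1 \/ k = 0 \/ k = 1)%Z as [->|[->| ->]] by lia.
  - replace (-1 * PI) with (- PI) in Hc by ring. rewrite cos_neg, cos_PI in Hc. lra.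
  - ring.
  - rewrite Rmult_1_l, cos_PI in Hc. lra.
Qed.

(** Exactly one of the orders [(a, b)] and [(b, a)] of non-parallel directions is a right turn; the
    shift by one half makes the count antisymmetric. *)
Definition turn (a b : vec) : R :=
  (if Rlt_dec (cross a b) 0 then 1 else 0) - / 2 + angle a b / PI.

Lemma turn_anti (a b : vec) : cross a b <> 0 -> turn b a = - turn a b.
Proof.
  intros H. unfold turn. rewrite angle_anti by exact H. rewrite (cross_anti b a).
  assert (HPI := PI_RGT_0).
  destruct (Rlt_dec (cross a b) 0), (Rlt_dec (- cross a b) 0); try lra; field; lra.
Qed.

(** The three angles sum to a multiple of [2 * PI]: to [2 * PI] with no right turn, [0] with one or
    two, [- 2 * PI] with three. The left side is therefore one half for an even number of right
    turns and minus one half for an odd number. *)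
Lemma turn_triangle (a b c : vec) :
  cross a b <> 0 -> cross b c <> 0 -> cross c a <> 0 ->
  turn a b + turn b c + turn c a =
  (if Rlt_dec 0 (cross a b * cross b c * cross c a) then 1 else 0) - / 2.
Proof.
  intros Hab Hbc Hca. assert (HPI := PI_RGT_0).
  assert (Ha := dot_self_pos a b Hab). assert (Hb := dot_self_pos b c Hbc).
  assert (Hc := dot_self_pos c a Hca).
  destruct (angle_spec a b Hab) as [p [Hp [Bp [Dp [Cp [Pp Np]]]]]].
  destruct (angle_spec b c Hbc) as [q [Hq [Bq [Dq [Cq [Pq Nq]]]]]].
  destruct (angle_spec c a Hca) as [r [Hr [Br [Dr [Cr [Pr Nr]]]]]].
  unfold turn.
  set (x := angle a b) in *. set (y := angle b c) in *. set (z := angle c a) in *.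
  assert (Hpqr : 0 < p * q * r) by (repeat apply Rmult_lt_0_compat; assumption).
  (* The product of the complex numbers [conj a * b], [conj b * c] and [conj c * a]
     is a positive real. *)
  assert (Hsin : sin (x + y + z) = 0).
  { apply Rmult_eq_reg_l with (p * q * r); [|lra].
    transitivity ((p * sin x) * (q * cos y) * (r * cos z)
      + (p * cos x) * (q * sin y) * (r * cos z) + (p * cos x) * (q * cos y) * (r * sin z)
      - (p * sin x) * (q * sin y) * (r * sin z)).
    - rewrite !sin_plus, !cos_plus. ring.
    - rewrite <- Dp, <- Cp, <- Dq, <- Cq, <- Dr, <- Cr. unfold dot, cross. ring. }
  assert (Hcos : 0 < cos (x + y + z)).
  { apply Rmult_lt_reg_l with (p * q * r); [lra|]. rewrite Rmult_0_r.
    replace (p * q * r * cos (x + y + z)) with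
      ((p * cos x) * (q * cos y) * (r * cos z) - (p * sin x) * (q * sin y) * (r * cos z)
       - (p * sin x) * (q * cos y) * (r * sin z) - (p * cos x) * (q * sin y) * (r * sin z))
      by (rewrite !cos_plus, !sin_plus; ring).
    rewrite <- Dp, <- Cp, <- Dq, <- Cq, <- Dr, <- Cr.
    replace (_ - _) with (dot a a * dot b b * dot c c) by (unfold dot, cross; ring).
    repeat apply Rmult_lt_0_compat; assumption. }
  (* [S0], [S1], [S2] are the three possible sums, each selected by the bounds that the signs of the
     angles provide. *)
  assert (S0 : - (2 * PI) < x + y + z < 2 * PI -> x / PI + y / PI + z / PI = 0).
  { intros Hb'. assert (E := sin0_cos_pos _ Hsin Hcos Hb').
    replace (x / PI + y / PI + z / PI) with ((x + y + z) / PI) by (field; lra).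
    rewrite E. field. lra. }
  assert (S1 : 0 < x + y + z < 4 * PI -> x / PI + y / PI + z / PI = 2).
  { intros Hb'.
    assert (E : x + y + z - 2 * PI = 0).
    { apply sin0_cos_pos; [| |lra].
      - rewrite sin_minus, sin_2PI, cos_2PI, Hsin. ring.
      - rewrite cos_minus, sin_2PI, cos_2PI. lra. }
    replace (x / PI + y / PI + z / PI) with ((x + y + z - 2 * PI) / PI + 2) by (field; lra).
    rewrite E. field. lra. }
  assert (S2 : - (4 * PI) < x + y + z < 0 -> x / PI + y / PI + z / PI = - 2).
  { intros Hb'.
    assert (E : x + y + z + 2 * PI = 0).
    { apply sin0_cos_pos; [| |lra].
      - rewrite sin_plus, sin_2PI, cos_2PI, Hsin. ring.
      - rewrite cos_plus, sin_2PI, cos_2PI. lra. }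
    replace (x / PI + y / PI + z / PI) with ((x + y + z + 2 * PI) / PI - 2) by (field; lra).
    rewrite E. field. lra. }
  clear Dp Cp Dq Cq Dr Cr Hsin Hcos.
  destruct (Rlt_dec (cross a b) 0) as [L1|L1], (Rlt_dec (cross b c) 0) as [L2|L2],
    (Rlt_dec (cross c a) 0) as [L3|L3];
  destruct (Rlt_dec 0 (cross a b * cross b c * cross c a)) as [L|L];
  try (specialize (Np L1)); try (specialize (Nq L2)); try (specialize (Nr L3));
  try (specialize (Pp ltac:(lra))); try (specialize (Pq ltac:(lra)));
  try (specialize (Pr ltac:(lra)));
  try (first [specialize (S2 ltac:(lra)); clear S0 S1 | specialize (S1 ltac:(lra)); clear S0 S2
             | specialize (S0 ltac:(lra)); clear S1 S2]);
  try lra; exfalso.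
  all: set (u := cross a b) in *; set (v := cross b c) in *; set (w := cross c a) in *.
  all: clearbody u v w.
  all: assert (Huv : u * v < 0 \/ 0 < u * v) by (assert (u * v <> 0) by
         (apply Rmult_integral_contrapositive_currified; assumption); lra).
  all: destruct Huv as [Huv|Huv]; nra.
Qed.

(** * The winding number of a tangential polygon *)

(** The half-angle formula [(1 - cos t) / sin t = tan (t / 2)], multiplied through by
    [vnorm a * vnorm b]. *)
Lemma angle_corner_tan (a b : vec) :
  cross a b <> 0 ->
  0 < cos (angle a b / 2) /\
  (vnorm a * vnorm b - dot a b) / cross a b = sin (angle a b / 2) / cos (angle a b / 2).
Proof.
  intros H. destruct (angle_spec a b H) as [rho [Hrho [Ht [Ed [Ec _]]]]].
  assert (Hc : 0 < cos (angle a b / 2)) by (apply cos_gt_0; lra).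
  split; [exact Hc|].
  assert (Hr : rho = vnorm a * vnorm b).
  { assert (0 <= vnorm a * vnorm b) by (apply Rmult_le_pos; apply sqrt_pos).
    apply Rsqr_inj; [lra|assumption|]. unfold Rsqr.
    replace (vnorm a * vnorm b * (vnorm a * vnorm b))
      with ((vnorm a * vnorm a) * (vnorm b * vnorm b)) by ring.
    rewrite !vnorm_sqr.
    replace (dot a a * dot b b) with (dot a b * dot a b + cross a b * cross a b)
      by (unfold dot, cross; ring).
    rewrite Ed, Ec. assert (E := sin2_cos2 (angle a b)). unfold Rsqr in E. nra. }
  rewrite <- Hr. rewrite Ec in H |- *. rewrite Ed. set (t := angle a b) in *.
  replace t with (2 * (t / 2)) in H by field.
  replace (cos t) with (cos (2 * (t / 2))) by (f_equal; field).
  replace (sin t) with (sin (2 * (t / 2))) by (f_equal; field).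
  rewrite cos_2a_sin. rewrite sin_2a in *. field. split; [lra|].
  split; intros E; rewrite ?E in H; lra.
Qed.

(** Seen from the center, the tangency point on the middle line splits the side into two parts, each
    subtending half of the angle between adjacent directions. The sign of [r] only reflects both
    vertices in the center. *)
Lemma angle_tangential_vertices (a b c : vec) (r : R) :
  r <> 0 -> cross a b <> 0 -> cross b c <> 0 ->
  angle (line_meet a (- r * vnorm a) b (- r * vnorm b))
        (line_meet b (- r * vnorm b) c (- r * vnorm c)) =
  angle a b / 2 + angle b c / 2.
Proof.
  intros Hr Hab Hbc.
  destruct (angle_corner_tan a b Hab) as [C1 T1].
  destruct (angle_corner_tan b c Hbc) as [C2 T2].
  destruct (angle_spec a b Hab) as [_ [_ [B1 _]]].
  destruct (angle_spec b c Hbc) as [_ [_ [B2 _]]].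
  assert (Hb := vnorm_pos b c Hbc). assert (Eb := vnorm_sqr b).
  assert (Hr2 : 0 < r * r) by (apply Rsqr_pos_lt; exact Hr).
  set (P := line_meet a _ b _). set (Q := line_meet b _ c _).
  set (t1 := angle a b / 2) in *. set (t2 := angle b c / 2) in *.
  (* The radius is the product of the distances of the two vertices from the center. *)
  apply (angle_polar _ _ (r * r / (cos t1 * cos t2))).
  - apply Rdiv_lt_0_compat; [exact Hr2|apply Rmult_lt_0_compat; assumption].
  - unfold t1, t2. lra.
  - assert (EP : dot P b = - r * vnorm b * (sin t1 / cos t1)).
    { rewrite <- T1. unfold P.
      transitivity ((- r * vnorm a * dot b b + r * vnorm b * dot a b) / cross a b).
      - unfold line_meet, dot, cross in *; simpl. field. exact Hab.
      - rewrite <- Eb. field. exact Hab. }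
    assert (EQ : dot Q b = r * vnorm b * (sin t2 / cos t2)).
    { rewrite <- T2. unfold Q.
      transitivity ((- r * vnorm b * dot b c + r * vnorm c * dot b b) / cross b c).
      - unfold line_meet, dot, cross in *; simpl. field. exact Hbc.
      - rewrite <- Eb. field. exact Hbc. }
    assert (XP : cross b P = - r * vnorm b).
    { unfold P, line_meet, cross in *; simpl. field. exact Hab. }
    assert (XQ : cross b Q = - r * vnorm b).
    { unfold Q, line_meet, cross in *; simpl. field. exact Hbc. }
    apply Rmult_eq_reg_r with (dot b b); [|rewrite <- Eb; apply Rgt_not_eq; nra].
    replace (dot P Q * dot b b) with (dot P b * dot Q b + cross b P * cross b Q)
      by (unfold dot, cross; ring).
    rewrite EP, EQ, XP, XQ, <- Eb, cos_plus. field. lra.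
  - unfold P, Q. rewrite cross_line_meet by assumption. rewrite <- Eb.
    transitivity (r * r * ((vnorm a * vnorm b - dot a b) / cross a b +
                           (vnorm b * vnorm c - dot b c) / cross b c)).
    + field. repeat split; lra.
    + rewrite T1, T2, sin_plus. field. lra.
Qed.

Lemma winding_tangential s n h r :
  (3 <= n)%nat -> pairwise_nonparallel s n -> Tangential s n h (0, 0) r ->
  winding s n h = rsum n (fun i => angle (s i) (s (nxt n i))) / (2 * PI).
Proof.
  intros Hn HP HT. unfold winding. f_equal.
  pose (half := fun i => angle (s i) (s (nxt n i)) / 2).
  rewrite (rsum_ext n _ (fun i => half i + half (nxt n i))).
  - rewrite rsum_plus, (rsum_nxt n half), <- rsum_plus. apply rsum_ext.
    intros i Hi. unfold half. field.
  - intros i Hi. assert (Hi' : (nxt n i < n)%nat) by (apply nxt_lt; lia).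
    assert (Hi'' : (nxt n (nxt n i) < n)%nat) by (apply nxt_lt; lia).
    unfold vertex. rewrite !(tangential_offset s n h r _ Hn HP HT) by assumption.
    apply angle_tangential_vertices; [apply HT| |]; apply HP; try assumption;
      apply not_eq_sym, nxt_neq; lia.
Qed.

(** The sum of [turn] is computed twice: around the cycle it is [RT - n / 2] plus twice the winding
    number, over the fan it is the count minus [(n - 2) / 2]. *)
Lemma count_fan_orient s n h r :
  (3 <= n)%nat -> pairwise_nonparallel s n -> Tangential s n h (0, 0) r ->
  INR (count (fun k => is_neg (- fan_orient s k)) (n - 2)) =
  INR (RT s n) - 1 + 2 * winding s n h.
Proof.
  intros Hn HP HT. rewrite (winding_tangential s n h r Hn HP HT).
  assert (HPI := PI_RGT_0).
  assert (E := rsum_cycle_fan n (fun i j => turn (s i) (s j)) ltac:(lia)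
    ltac:(intros; apply turn_anti; apply HP; lia)). simpl in E.
  rewrite (rsum_ext (n - 2) _
    (fun k => INR (if is_neg (- fan_orient s k) then 1%nat else 0%nat) + - / 2)) in E.
  2:{ intros k Hk. rewrite turn_triangle by (apply HP; lia).
      fold (fan_orient s k). unfold is_neg.
      destruct (Rlt_dec 0 (fan_orient s k)), (Rlt_dec (- fan_orient s k) 0); simpl; lra. }
  rewrite rsum_plus, rsum_const, <- INR_natsum in E.
  fold (count (fun k => is_neg (- fan_orient s k)) (n - 2)) in E.
  rewrite (rsum_ext n _ (fun i =>
    (INR (if Rlt_dec (cross (s i) (s (nxt n i))) 0 then 1%nat else 0%nat) + - / 2)
     + / PI * angle (s i) (s (nxt n i)))) in E.
  2:{ intros i Hi. unfold turn. destruct (Rlt_dec (cross (s i) (s (nxt n i))) 0);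
        simpl; field; lra. }
  rewrite !rsum_plus, rsum_const, rsum_scal, <- INR_natsum in E.
  fold (RT s n) in E. rewrite minus_INR in E by lia. simpl (INR 2) in E.
  replace (2 * (rsum n (fun i => angle (s i) (s (nxt n i))) / (2 * PI)))
    with (/ PI * rsum n (fun i => angle (s i) (s (nxt n i)))) by (field; lra).
  lra.
Qed.

(** * Complementary turns and the point reflection *)

Lemma RT_plus_LT s n :
  (3 <= n)%nat -> pairwise_nonparallel s n -> (RT s n + LT s n = n)%nat.
Proof.
  intros Hn HP.
  assert (E := count_compl
    (fun i => if Rlt_dec (cross (s i) (s (nxt n i))) 0 then true else false)
    (fun i => if Rlt_dec 0 (cross (s i) (s (nxt n i))) then true else false) n).
  rewrite <- E at 3.
  - unfold count, RT, LT. f_equal; f_equal; extensionality i;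
      destruct Rlt_dec; reflexivity.
  - intros i Hi.
    assert (cross (s i) (s (nxt n i)) <> 0).
    { apply HP; [exact Hi|apply nxt_lt; lia|apply not_eq_sym, nxt_neq; lia]. }
    destruct (Rlt_dec (cross (s i) (s (nxt n i))) 0),
      (Rlt_dec 0 (cross (s i) (s (nxt n i)))); simpl; reflexivity || lra.
Qed.

Lemma area_opp s n h :
  (3 <= n)%nat -> pairwise_nonparallel s n -> area s n (fun i => - h i) = area s n h.
Proof.
  intros Hn HP. rewrite !area_fan_bil by assumption. f_equal.
  apply rsum_ext. intros k Hk. unfold fan_form. ring.
Qed.

Lemma perimeter_opp s n h :
  (3 <= n)%nat -> pairwise_nonparallel s n -> perimeter s n (fun i => - h i) = - perimeter s n h.
Proof.
  intros Hn HP. rewrite !perimeter_fan_bil by assumption.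
  rewrite <- (Rmult_1_l (fan_bil s n _ h)), Ropp_mult_distr_l.
  unfold fan_bil, diag_form. rewrite <- rsum_scal.
  apply rsum_ext. intros k Hk. unfold fan_form. ring.
Qed.

Lemma Tangential_opp s n h r :
  Tangential s n h (0, 0) r -> Tangential s n (fun i => - h i) (0, 0) (- r).
Proof.
  intros [Hr HT]. split; [lra|]. intros i Hi. rewrite <- (HT i Hi).
  unfold signed_dist, cross, Rdiv; simpl. ring.
Qed.

Theorem mainTheorem6 (n : nat) (s : nat -> vec) (h : nat -> R) (r : R) :
  (3 <= n)%nat ->
  (forall i j, (i < n)%nat -> (j < n)%nat -> i <> j -> cross (s i) (s j) <> 0) ->
  Rabs (area s n h) = 1 ->
  Tangential s n h (0, 0) r ->
  (0 < r ->
     CriticalS s n h /\ NondegS s n h /\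
     exists m, MorseIndex s n h m /\
       INR m = INR (RT s n) - 1 + 2 * winding s n h
               - indicator_pos (perimeter s n h)) /\
  (r < 0 ->
     exists m m', MorseIndex s n h m /\ MorseIndex s n (fun i => - h i) m' /\
       (m + m' = n - 3)%nat /\
       INR m = INR (LT s n) - 1 - 2 * winding s n h
               - indicator_pos (perimeter s n h)).
Proof.
  intros Hn HP HA HT.
  assert (Hcount := count_fan_orient s n h r Hn HP HT).
  destruct (tangential_morse_index s n h r Hn HP HA HT) as [m [Hm Em]].
  assert (HX : forall k, (k < n - 2)%nat -> fan_orient s k <> 0)
    by (intros k Hk; apply (fan_orient_neq0 s n k HP Hk)).
  assert (Hind : INR (if Rlt_dec 0 (perimeter s n h) then 1%nat else 0%nat) =
                 indicator_pos (perimeter s n h)).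
  { unfold indicator_pos. destruct (Rlt_dec 0 (perimeter s n h)); reflexivity. }
  split; intros Hr.
  - split; [exact (tangential_critical s n h r Hn HP HT)|].
    split; [exact (tangential_nondegenerate s n h r Hn HP HA HT)|].
    exists m. split; [exact Hm|].
    rewrite <- Hcount, <- Hind.
    rewrite (count_ext _ (fun k => is_neg (- (fan_orient s k * r)))).
    + rewrite <- Em, plus_INR. ring.
    + intros k Hk. unfold is_neg.
      destruct (Rlt_dec (- fan_orient s k) 0), (Rlt_dec (- (fan_orient s k * r)) 0);
        reflexivity || nra.
  (* The reflected polygon has positive signed radius [- r], the same area and the opposite
     perimeter. *)
  - destruct (tangential_morse_index s n (fun i => - h i) (- r)) as [m' [Hm' Em']];
      [assumption|assumption| |apply Tangential_opp, HT|].
    { rewrite area_opp; assumption. }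
    rewrite perimeter_opp in Em' by assumption.
    assert (HPn0 : perimeter s n h <> 0).
    { intros E. assert (E' := tangential_fan_bil s n h r h Hn HP HT).
      rewrite E, Rmult_0_r in E'. rewrite area_fan_bil, E', Rmult_0_r, Rabs_R0 in HA by assumption.
      lra. }
    (* Changing the sign of [r] flips every coefficient, and none of them is zero. *)
    assert (Ecompl : (count (fun k => is_neg (- (fan_orient s k * r))) (n - 2) +
                      count (fun k => is_neg (- (fan_orient s k * - r))) (n - 2) = n - 2)%nat).
    { apply count_compl. intros k Hk. specialize (HX k Hk). unfold is_neg.
      assert (fan_orient s k * r <> 0)
        by (apply Rmult_integral_contrapositive_currified; lra).
      destruct (Rlt_dec (- (fan_orient s k * r)) 0), (Rlt_dec (- (fan_orient s k * - r)) 0);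
        simpl; reflexivity || lra. }
    rewrite (count_ext (fun k => is_neg (- fan_orient s k))
      (fun k => is_neg (- (fan_orient s k * - r)))) in Hcount.
    2:{ intros k Hk. unfold is_neg.
        destruct (Rlt_dec (- fan_orient s k) 0), (Rlt_dec (- (fan_orient s k * - r)) 0);
          reflexivity || nra. }
    exists m, m'. split; [exact Hm|]. split; [exact Hm'|]. split.
    (* The perimeter is nonzero, so exactly one of the two polygons loses a negative square; this
       turns [n - 2] into [n - 3]. *)
    + rewrite <- Em, <- Em' in Ecompl.
      destruct (Rlt_dec 0 (perimeter s n h)), (Rlt_dec 0 (- perimeter s n h)); lra || lia.
    (* Here [m] is [n - 2] minus the count for [- r] minus the indicator; substituting [n = RT + LT]
       turns the right-turn formula into the left-turn one. *)
    + rewrite <- Em in Ecompl.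
      apply (f_equal INR) in Ecompl. rewrite !plus_INR, Hcount, Hind, minus_INR in Ecompl by lia.
      assert (E2 := RT_plus_LT s n Hn HP). apply (f_equal INR) in E2. rewrite plus_INR in E2.
      simpl (INR 2) in Ecompl. lra.
Qed.
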